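(* Let $p\in(\tfrac{10}{3},6]$, $\gamma>0$, $a>0$. There exist two constants $K_1>0$ and $K_2>0$ such that for any $c\in(0,c_1)$, if $\lambda_c^+\in\mathbb{R}$ is the Lagrange parameter associated to a solution $u_c^+$ lying at the level $\gamma^+(c)$ (that is, $u_c^+\in\Lambda^+(c)$, $F(u_c^+)=\gamma^+(c)$, and $u=u_c^+$ solves $-\Delta u+\lambda u-\gamma(|x|^{-1}*|u|^2)u-a|u|^{p-2}u=0$ in $\mathbb{R}^3$ with $\lambda=\lambda_c^+$), then $$|\gamma^+(c)|\le K_1c^3\qquad\text{and}\qquad\lambda_c^+\le K_2c^2 .$$
   Context: $H^1(\mathbb{R}^3)$ is the usual Sobolev space of real-valued functions; solutions are weak solutions in $H^1(\mathbb{R}^3)$. For $u\in H^1(\mathbb{R}^3)$, $$A(u)=\int_{\mathbb{R}^3}|\nabla u|^2dx,\quad B(u)=\int_{\mathbb{R}^3}\int_{\mathbb{R}^3}\frac{|u(x)|^2|u(y)|^2}{|x-y|}dxdy,\quad C(u)=\int_{\mathbb{R}^3}|u|^pdx,$$ $F(u)=\frac12A(u)-\frac\gamma4B(u)-\frac apC(u)$, and $\sigma=\frac{3(p-2)}{2}\in(2,6]$. $S(c)=\{u\in H^1(\mathbb{R}^3):\|u\|_{L^2}^2=c\}$. $K_H,K_{GN}>0$ are fixed constants, independent of $u$ and $c$, such that for every $c>0$ and $u\in S(c)$: $B(u)\le K_H\sqrt{A(u)}\,c^{3/2}$ and $C(u)\le K_{GN}[A(u)]^{\sigma/2}c^{(6-p)/4}$.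 Moreover $$c_1=\left(\frac{4}{\gamma K_H}\,\frac{\sigma-2}{\sigma-1}\right)^{\frac{3p-10}{4(p-3)}}\left(\frac{p}{a\sigma(\sigma-1)K_{GN}}\right)^{\frac{1}{2(p-3)}}.$$ For $u\in S(c)$ and $t>0$ put $u^t(x)=t^{3/2}u(tx)$ and $g_u(t)=F(u^t)=\frac12t^2A(u)-\frac\gamma4tB(u)-\frac apt^\sigma C(u)$. Define $\Lambda^+(c)=\{u\in S(c):g_u'(1)=0,\ g_u''(1)>0\}$ and $\gamma^+(c)=\inf_{u\in\Lambda^+(c)}F(u)$. *)

(* Defs.v *)
From HB Require Import structures.
From mathcomp Require Import all_boot all_order all_algebra.
From mathcomp Require Import all_classical all_reals all_analysis.

Set Implicit Arguments.
Unset Strict Implicit.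
Unset Printing Implicit Defensive.

Import Order.TTheory GRing.Theory Num.Theory.
Import numFieldNormedType.Exports.

Local Open Scope classical_set_scope.
Local Open Scope ring_scope.

(* Iterated products carry the product topology, the product (= Borel)
   sigma-algebra and the product measure. The library norm on them is the sup
   norm; the Euclidean norm is [enorm]. *)
Notation R3 R :=
  (measurableTypeR R * measurableTypeR R * measurableTypeR R)%type.

Definition leb3 (R : realType) : {measure set (R3 R) -> \bar R} :=
  ((@lebesgue_measure R \x @lebesgue_measure R) \x @lebesgue_measure R)%E.
Arguments leb3 : clear implicits.

Definition enorm (R : realType) (x : R3 R) : R :=
  Num.sqrt ((x.1.1 : R) ^+ 2 + (x.1.2 : R) ^+ 2 + (x.2 : R) ^+ 2).

Definition basis3 (R : realType) (i : 'I_3) : R3 R :=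
  ((i == 0 :> nat)%:R : R, (i == 1 :> nat)%:R : R, (i == 2 :> nat)%:R : R).
Arguments basis3 : clear implicits.

(* For s = [:: i1; ...; ik] this is d_(i1) (... (d_(ik) f)). *)
Definition iter_partial (R : realType) (s : seq 'I_3) (f : R3 R -> R) :
    R3 R -> R :=
  foldr (fun i g => 'D_(basis3 R i) g) f s.

Definition smooth (R : realType) (f : R3 R -> R) : Prop :=
  forall s : seq 'I_3,
    continuous (iter_partial s f) /\
    forall (i : 'I_3) (x : R3 R), derivable (iter_partial s f) x (basis3 R i).

(* C_c^oo(R^3) *)
Definition test_function (R : realType) (phi : R3 R -> R) : Prop :=
  smooth phi /\ compact (closure [set x | phi x != 0]).

Definition is_weak_partial (R : realType) (i : 'I_3) (u v : R3 R -> R) : Prop :=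
  forall phi : R3 R -> R, test_function phi ->
    \int[leb3 R]_x (u x * 'D_(basis3 R i) phi x) =
    - \int[leb3 R]_x (v x * phi x).

(* H^1(R^3), as a set of (Borel) representatives *)
Definition H1 (R : realType) : set (R3 R -> R) :=
  [set u | u \in Lfun (leb3 R) 2%:E /\
     forall i : 'I_3, exists2 v, v \in Lfun (leb3 R) 2%:E & is_weak_partial i u v].
Arguments H1 : clear implicits.

(* A chosen representative of the weak derivative, which is unique almost
   everywhere; 0 when there is none in L^2. *)
Definition weak_partial (R : realType) (i : 'I_3) (u : R3 R -> R) :
    R3 R -> R :=
  xget (cst 0) [set v | v \in Lfun (leb3 R) 2%:E /\ is_weak_partial i u v].

Definition grad_dot (R : realType) (u v : R3 R -> R) (x : R3 R) : R :=
  \sum_(i < 3) weak_partial i u x * weak_partial i v x.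

Definition Afun (R : realType) (u : R3 R -> R) : \bar R :=
  (\int[leb3 R]_x (grad_dot u u x)%:E)%E.

(* Since 0^-1 = 0, the kernels below vanish on the diagonal, a null set. *)
Definition Bfun (R : realType) (u : R3 R -> R) : \bar R :=
  (\int[leb3 R]_x \int[leb3 R]_y
     (`|u x| ^+ 2 * `|u y| ^+ 2 / enorm (x - y))%:E)%E.

Definition Cfun (R : realType) (p : R) (u : R3 R -> R) : \bar R :=
  (\int[leb3 R]_x (`|u x| `^ p)%:E)%E.

(* Afun, Bfun and Cfun are finite on H^1(R^3) for 2 <= p <= 6. *)
Definition Ffun (R : realType) (p gam a : R) (u : R3 R -> R) : R :=
  1 / 2 * fine (Afun u) - gam / 4 * fine (Bfun u) - a / p * fine (Cfun p u).

Definition sigma (R : realType) (p : R) : R := 3 * (p - 2) / 2.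

Definition sphere (R : realType) (c : R) : set (R3 R -> R) :=
  [set u | H1 R u /\ (('N[leb3 R]_2%:E[EFin \o u]) ^+ 2)%E = c%:E].

Definition c1 (R : realType) (p gam a KH KGN : R) : R :=
  (4 / (gam * KH) * ((sigma p - 2) / (sigma p - 1)))
    `^ ((3 * p - 10) / (4 * (p - 3)))
  * (p / (a * sigma p * (sigma p - 1) * KGN)) `^ (1 / (2 * (p - 3))).

Definition dilation (R : realType) (t : R) (u : R3 R -> R) : R3 R -> R :=
  fun x => t `^ (3 / 2) * u (t *: x).

Definition fiber (R : realType) (p gam a : R) (u : R3 R -> R) (t : R) : R :=
  Ffun p gam a (dilation t u).

Definition Lambda_plus (R : realType) (p gam a c : R) : set (R3 R -> R) :=
  [set u | [/\ sphere c u, derive1 (fiber p gam a u) 1 = 0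
             & 0 < derive1n 2 (fiber p gam a u) 1]].

Definition gamma_plus (R : realType) (p gam a c : R) : \bar R :=
  ereal_inf [set (Ffun p gam a u)%:E | u in Lambda_plus p gam a c].

(* The Newtonian potential |x|^-1 * |u|^2 *)
Definition potential (R : realType) (u : R3 R -> R) (x : R3 R) : \bar R :=
  (\int[leb3 R]_y (`|u y| ^+ 2 / enorm (x - y))%:E)%E.

(* - Delta u + lam u - gam (|x|^-1 * |u|^2) u - a |u|^(p-2) u = 0 holds weakly in
   H^1(R^3), i.e. in its dual. The potential is finite almost everywhere. *)
Definition weak_solution (R : realType) (p gam a lam : R) (u : R3 R -> R) :
    Prop :=
  H1 R u /\ forall phi : R3 R -> R, H1 R phi ->
    \int[leb3 R]_x (grad_dot u phi x)
    + lam * \int[leb3 R]_x (u x * phi x)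
    - gam * \int[leb3 R]_x (fine (potential u x) * u x * phi x)
    - a * \int[leb3 R]_x (`|u x| `^ (p - 2) * u x * phi x) = 0.

(* Main.v *)
(* With A, B, C the three functionals, the rescaled functions satisfy
   F(u^t) = t^2 A/2 - gam t B/4 - a t^sigma C/p for t > 0, so membership in
   Lambda^+ says A - gam B/4 - a sigma C/p = 0 and a sigma (sigma-1) C/p < A.
   Eliminating C gives (sigma-2) A < gam (sigma-1) B/4 <= const sqrt(A) c^(3/2),
   hence A <= M^2 c^3. Then F(u) = -A/2 + a (sigma-1) C/p is bounded by A, and
   testing the equation with u itself gives lam c <= gam B + a C <= K2 c^3.

   The scaling of A needs uniqueness of the weak derivative: the products of
   the bumps exp(-1/x) are test functions converging boundedly to the
   indicators of half-open boxes, and these boxes form a pi-system generating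
   the Borel sets. *)
Require Import Defs.
From HB Require Import structures.
From mathcomp Require Import all_boot all_order all_algebra.
From mathcomp Require Import all_classical all_reals all_analysis.
From mathcomp Require Import measurable_realfun.
From mathcomp Require Import ring lra.

Set Implicit Arguments.
Unset Strict Implicit.
Unset Printing Implicit Defensive.

Import Order.TTheory GRing.Theory Num.Theory.
Import numFieldNormedType.Exports.

Local Open Scope classical_set_scope.
Local Open Scope ring_scope.

(** * Change of variables *)

(** The integrals are total: [fine] reads an infinite value as 0, and [is_weak_partial] compares
    such integrals without an integrability clause. The substitution y = t x is therefore proved for
    arbitrary functions, infinite integrals included. The scaling laws then hold before any
    finiteness is known, and the inner integral of [Bfun] can be rescaled without checking that it
    is measurable in x. B and C rescale pointwise under the integral sign, but A does not, because
    [weak_partial] picks a representative. Comparing two picks takes explicit test functions. Since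
    [smooth] constrains every iterated partial, these are drawn from a class closed under
    differentiation: tensors of sums of products of functions P(1/x) exp(-1/x) with affine
    arguments. *)

Section ge0_integral_change.
Local Open Scope ereal_scope.
Context d (T : measurableType d) (R : realType).
Variable mu : {measure set T -> \bar R}.

Import HBNNSimple.

(** The integral of a nonnegative function is a supremum over the simple functions below it, and a
    larger function admits more of them. *)
Lemma ge0_le_integral_nomeas (f g : T -> \bar R) :
  (forall x, 0 <= f x) -> (forall x, f x <= g x) ->
  \int[mu]_x f x <= \int[mu]_x g x.
Proof.
move=> f0 fg.
rewrite !ge0_integralTE//; last by move=> x; exact: le_trans (fg x).
apply: le_ereal_sup => _ [h hf <-]; exists h => //= x.
exact: le_trans (fg x).
Qed.

(** A simple h below f gives k (h o s) below k (f o s), and s pushes mu forward to j mu; only h has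
    to be measurable for this. *)
Let le_integral_change (s : T -> T) (j k : R) (f : T -> \bar R) :
  measurable_fun setT s -> (0 < j)%R -> (0 < k)%R ->
  (forall A, measurable A -> mu (s @^-1` A) = j%:E * mu A) ->
  (forall x, 0 <= f x) ->
  (k * j)%:E * \int[mu]_x f x <= \int[mu]_x (k%:E * f (s x)).
Proof.
move=> ms j0 k0 sE f0.
have kf0 x : 0 <= k%:E * f (s x) by rewrite mule_ge0// lee_fin ltW.
rewrite (ge0_integralTE _ f0).
rewrite muleC -lee_pdivlMr ?mulr_gt0//.
apply: ge_ereal_sup => _ [h hf <-].
rewrite lee_pdivlMr ?mulr_gt0//.
have mhs : measurable_fun setT (fun x => (h (s x))%:E).
  by apply/measurable_EFinP; exact: measurableT_comp.
pose jnn : {nonneg R} := NngNum (ltW j0).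
have -> : sintegral mu h * (k * j)%:E = \int[mu]_x (k%:E * (h (s x))%:E).
  rewrite ge0_integralZl//; last 2 first.
  - by move=> x _; rewrite lee_fin.
  - by rewrite lee_fin ltW.
  have := @ge0_integral_pushforward _ _ _ _ _ s ms mu setT (EFin \o h) measurableT.
  rewrite preimage_setT => <-; last 2 first.
  - exact/measurable_EFinP.
  - by move=> x _; rewrite lee_fin.
  rewrite (@eq_measure_integral _ _ _ _ (mscale jnn mu)); last first.
    by move=> A mA _; rewrite /pushforward/= /mscale/= -sE.
  rewrite ge0_integral_mscale//; last 2 first.
  - exact/measurable_EFinP.
  - by move=> x _; rewrite lee_fin.
  by rewrite (integralT_nnsfun mu h) muleA -EFinM muleC.
apply: ge0_le_integral_nomeas => x.
  by rewrite mule_ge0// lee_fin// ltW.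
by rewrite lee_pmul2l.
Qed.

(* Both inequalities come from the supremum over simple functions, so [f] need
   not be measurable. *)
Lemma ge0_integral_change (s s' : T -> T) (j k : R) (f : T -> \bar R) :
  measurable_fun setT s -> measurable_fun setT s' ->
  cancel s s' -> cancel s' s ->
  (0 < j)%R -> (0 < k)%R ->
  (forall A, measurable A -> mu (s @^-1` A) = j%:E * mu A) ->
  (forall x, 0 <= f x) ->
  \int[mu]_x (k%:E * f (s x)) = (k * j)%:E * \int[mu]_x f x.
Proof.
move=> ms ms' ss' s's j0 k0 sE f0.
have kf0 x : 0 <= k%:E * f (s x) by rewrite mule_ge0// lee_fin ltW.
apply/eqP; rewrite eq_le le_integral_change// andbT.
have s'E A : measurable A -> mu (s' @^-1` A) = j^-1%:E * mu A.
  move=> mA; have mA' : measurable (s' @^-1` A) by rewrite -[X in measurable X]setTI; exact: ms'.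
  have -> : mu A = mu (s @^-1` (s' @^-1` A)).
    by congr (mu _); apply/seteqP; split => x /=; rewrite ss'.
  by rewrite sE// muleA -EFinM mulVf ?gt_eqF// mul1e.
(* The reverse inequality is the same one for the inverse map, the inverse constants and the
   function k (f o s). *)
have := @le_integral_change s' j^-1 k^-1 (fun x => k%:E * f (s x)) ms'.
rewrite !invr_gt0 => /(_ j0 k0 s'E kf0).
under [X in _ <= X]eq_integral do rewrite s's muleA -EFinM mulVf ?gt_eqF// mul1e.
rewrite -invfM muleC -lee_pdivlMr ?invr_gt0 ?mulr_gt0//.
by rewrite invrK muleC mulrC.
Qed.

Lemma integral_change (s s' : T -> T) (j k : R) (f : T -> \bar R) :
  measurable_fun setT s -> measurable_fun setT s' ->
  cancel s s' -> cancel s' s -> (0 < j)%R -> (0 < k)%R ->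
  (forall A, measurable A -> mu (s @^-1` A) = j%:E * mu A) ->
  \int[mu]_x (k%:E * f (s x)) = (k * j)%:E * \int[mu]_x f x.
Proof.
move=> ms ms' ss' s's j0 k0 sE.
rewrite integralE [in RHS]integralE.
have k0' : 0 <= k%:E by rewrite lee_fin ltW.
have -> : \int[mu]_x (fun x => k%:E * f (s x))^\+ x = (k * j)%:E * \int[mu]_x f^\+ x.
  rewrite -(ge0_integral_change ms ms' ss' s's j0 k0 sE (fun x => funepos_ge0 f x)).
  by apply: eq_integral => x _; rewrite !funeposE maxe_pMr// mule0.
have -> : \int[mu]_x (fun x => k%:E * f (s x))^\- x = (k * j)%:E * \int[mu]_x f^\- x.
  rewrite -(ge0_integral_change ms ms' ss' s's j0 k0 sE (fun x => funeneg_ge0 f x)).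
  by apply: eq_integral => x _; rewrite !funenegE maxe_pMr// mule0 muleN.
have kj0 : (0 < k * j)%R by rewrite mulr_gt0.
have : 0 <= \int[mu]_x f^\- x by apply: integral_ge0 => x _; exact: funeneg_ge0.
have : 0 <= \int[mu]_x f^\+ x by apply: integral_ge0 => x _; exact: funepos_ge0.
(* When both parts are infinite their difference is -oo by convention, and a positive factor
   preserves it. *)
case: (\int[mu]_x f^\- x) => [r| |]//; case: (\int[mu]_x f^\+ x) => [q| |]// _ _.
- by congr EFin; rewrite mulrBr.
all: by rewrite /= ?gt0_muley ?gt0_muleNy ?lte_fin.
Qed.

End ge0_integral_change.

(** [t] times the pushforward of Lebesgue measure under x -> t x agrees with Lebesgue measure on
    half-open intervals, which determine it. *)
Lemma lebesgue_measure_scale (R : realType) (t : R) (A : set (measurableTypeR R)) :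
  0 < t -> measurable A ->
  (lebesgue_measure ((fun x : measurableTypeR R => (t * x)%R : measurableTypeR R) @^-1` A)
   = t^-1%:E * lebesgue_measure A)%E.
Proof.
move=> t0 mA.
pose s := fun x : measurableTypeR R => t * x : measurableTypeR R.
have ms : measurable_fun [set: measurableTypeR R] s by exact: mulrl_measurable.
pose tnn : {nonneg R} := NngNum (ltW t0).
pose nu : {measure set (measurableTypeR R) -> \bar R} := mscale tnn
  (measure_function_pushforward__canonical__measure_function_Measure lebesgue_measure ms).
have E B : measurable B -> lebesgue_measure B = nu B.
  move: B; apply: lebesgue_measure_unique => _ [[a b]] _ <-.
  change (lebesgue_measure `]a, b]%classic =
    t%:E * lebesgue_measure (s @^-1` `]a, b]%classic))%E.
  have -> : s @^-1` `]a, b]%classic = `]t^-1 * a, t^-1 * b]%classic.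
    apply/seteqP; split => x /=; rewrite !in_itv/= /s.
      by rewrite ler_pdivlMl// ltr_pdivrMl.
    by rewrite ler_pdivlMl// ltr_pdivrMl.
  rewrite !lebesgue_measure_itv/= !lte_fin ltr_pM2l ?invr_gt0//.
  case: ifPn => _; last by rewrite mule0.
  by rewrite -!EFinB -EFinM -mulrBr mulrA mulfV ?mul1r// gt_eqF.
rewrite [in RHS]E//.
change (lebesgue_measure (s @^-1` A) =
  t^-1%:E * (t%:E * lebesgue_measure (s @^-1` A)))%E.
rewrite muleA -EFinM mulVf ?gt_eqF//.
by rewrite mul1e.
Qed.

Section product_scale.
Local Open Scope ereal_scope.
Context d1 d2 (T1 : measurableType d1) (T2 : measurableType d2) (R : realType).
Variable m1 : {sigma_finite_measure set T1 -> \bar R}.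
Variable m2 : {sigma_finite_measure set T2 -> \bar R}.
Variables (s1 : T1 -> T1) (s2 : T2 -> T2) (j1 j2 : R).
Hypotheses (ms1 : measurable_fun setT s1) (ms2 : measurable_fun setT s2).
Hypotheses (j10 : (0 < j1)%R) (j20 : (0 < j2)%R).
Hypothesis s1E : forall A, measurable A -> m1 (s1 @^-1` A) = j1%:E * m1 A.
Hypothesis s2E : forall A, measurable A -> m2 (s2 @^-1` A) = j2%:E * m2 A.

Lemma measurable_product_map : measurable_fun setT (fun x => (s1 x.1, s2 x.2)).
Proof.
by apply: measurable_fun_pair; apply: measurableT_comp => //.
Qed.

(** The pushforward divided by j1 j2 gives each rectangle the product of the measures of its sides,
    which characterizes the product measure. *)
Lemma product_measure_scale X : measurable X ->
  (m1 \x m2) ((fun x => (s1 x.1, s2 x.2)) @^-1` X) = (j1 * j2)%:E * (m1 \x m2) X.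
Proof.
move=> mX.
pose s x := (s1 x.1, s2 x.2).
have ms : measurable_fun setT s by exact: measurable_product_map.
have j0 : (0 < (j1 * j2)^-1)%R by rewrite invr_gt0 mulr_gt0.
pose jnn : {nonneg R} := NngNum (ltW j0).
pose nu : {measure set (T1 * T2) -> \bar R} := mscale jnn
  (measure_function_pushforward__canonical__measure_function_Measure (m1 \x m2) ms).
rewrite [in RHS](@product_measure_unique _ _ _ _ _ m1 m2 nu _ X mX)//.
  change ((m1 \x m2) (s @^-1` X) =
    (j1 * j2)%:E * ((j1 * j2)^-1%:E * (m1 \x m2) (s @^-1` X))).
  rewrite muleA -EFinM mulfV ?mul1e// gt_eqF//.
  exact: mulr_gt0.
move=> A B mA mB.
change ((j1 * j2)^-1%:E * (m1 \x m2) (s @^-1` (A `*` B)) = m1 A * m2 B).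
have -> : s @^-1` (A `*` B) = (s1 @^-1` A) `*` (s2 @^-1` B) by [].
rewrite product_measure1E; last 2 first.
- by rewrite -[X in measurable X]setTI; exact: ms1.
- by rewrite -[X in measurable X]setTI; exact: ms2.
rewrite [X in _ * (X * _)](s1E mA) [X in _ * (_ * X)](s2E mB) [X in _ * X = _]muleACA.
transitivity (((j1 * j2)^-1 * (j1 * j2))%:E * (m1 A * m2 B)).
  by rewrite !EFinM -!muleA.
rewrite mulVf ?mul1e// gt_eqF//.
exact: mulr_gt0.
Qed.

End product_scale.

Section leb2.
Context (R : realType).
Notation mT := (measurableTypeR R).

Lemma sigma_finite_lebesgue_prod :
  sigma_finite setT (@lebesgue_measure R \x @lebesgue_measure R)%E.
Proof.
pose I n : set mT := `](- n%:R), n%:R]%classic.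
exists (fun n => I n `*` I n).
  apply/esym; rewrite -subTset => -[x y] _ /=.
  exists (Num.truncn (Num.max `|x| `|y|)).+1 => //=.
  have : Num.max `|x| `|y| < (Num.truncn (Num.max `|x| `|y|)).+1%:R.
    by rewrite truncnS_gt.
  rewrite gt_max !ltr_norml => /andP[/andP[x1 /ltW x2] /andP[y1 /ltW y2]].
  by split; rewrite /I/= in_itv/= ?x1 ?y1.
move=> n; have mI : measurable (I n) by exact: measurable_itv.
split; first exact: measurableX.
have fin : (lebesgue_measure (I n) < +oo)%E.
  by rewrite lebesgue_measure_itv/=; case: ifPn => _; rewrite ?ltry// -EFinB ltry.
rewrite product_measure1E//.
by apply: lte_mul_pinfty => //; rewrite ge0_fin_numE.
Qed.

(* The library's instance for products of subprobabilities shadows the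
   sigma-finite one. *)
Definition leb2 : {sigma_finite_measure set (mT * mT)%type -> \bar R} :=
  HB.pack (@lebesgue_measure R \x @lebesgue_measure R)%E
    (Measure_isSigmaFinite.Build _ _ _ (@lebesgue_measure R \x @lebesgue_measure R)%E
       sigma_finite_lebesgue_prod).

End leb2.
Arguments leb2 : clear implicits.

(** Infinite values are no exception: a positive factor preserves them and [fine] sends them to
    0. *)
Lemma fineMl_pos (R : realType) (k : R) (x : \bar R) :
  0 < k -> fine (k%:E * x)%E = k * fine x.
Proof.
by move=> k0; case: x => [r| |]//=; rewrite ?gt0_muley ?gt0_muleNy ?lte_fin//= mulr0.
Qed.

Section leb3_scale.
Context (R : realType).
Variables (t : R).
Hypothesis t0 : 0 < t.

Lemma measurable_scaler3 (r : R) :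
  measurable_fun [set: R3 R] (fun x : R3 R => r *: x : R3 R).
Proof.
apply: measurable_fun_pair.
  apply: measurable_fun_pair.
    apply: (@measurableT_comp _ _ _ _ _ _ (fun x : R => r * x)).
      exact: mulrl_measurable.
    by apply: measurableT_comp.
  apply: (@measurableT_comp _ _ _ _ _ _ (fun x : R => r * x)).
    exact: mulrl_measurable.
  by apply: measurableT_comp.
apply: (@measurableT_comp _ _ _ _ _ _ (fun x : R => r * x)) => //.
exact: mulrl_measurable.
Qed.

Lemma leb3_scale (A : set (R3 R)) : measurable A ->
  (leb3 R ((fun x : R3 R => t *: x : R3 R) @^-1` A) = (t ^- 3)%:E * leb3 R A)%E.
Proof.
move=> mA.
pose f := fun x : measurableTypeR R => t * x : measurableTypeR R.
have mf : measurable_fun setT f by exact: mulrl_measurable.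
have ti : 0 < t^-1 by rewrite invr_gt0.
have fE (B : set (measurableTypeR R)) : measurable B ->
    (lebesgue_measure (f @^-1` B) = t^-1%:E * lebesgue_measure B)%E.
  exact: lebesgue_measure_scale.
have := @product_measure_scale _ _ _ _ R (leb2 R) lebesgue_measure _ f _ _ (measurable_product_map mf mf) mf
  (mulr_gt0 ti ti) ti (product_measure_scale mf mf ti ti fE fE) fE A mA.
rewrite (_ : t^-1 * t^-1 / t = t ^- 3) //.
by rewrite !exprS expr0 mulr1 !invfM mulrA.
Qed.

Lemma ge0_integral_scale (k : R) (f : R3 R -> \bar R) :
  0 < k -> (forall x, 0 <= f x)%E ->
  (\int[leb3 R]_x (k%:E * f (t *: x)%R) = (k * t ^- 3)%:E * \int[leb3 R]_x f x)%E.
Proof.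
move=> k0 f0; apply: (@ge0_integral_change _ _ _ (leb3 R) (fun x => t *: x) (fun x => t^-1 *: x)) => //.
- exact: measurable_scaler3.
- exact: measurable_scaler3.
- by move=> x; rewrite scalerA mulVf ?scale1r ?gt_eqF.
- by move=> x; rewrite scalerA mulfV ?scale1r ?gt_eqF.
- by rewrite invr_gt0 exprn_gt0.
- exact: leb3_scale.
Qed.

(** Valid without integrability: an infinite integral stays infinite, and both sides are then 0. The
    integrands in [is_weak_partial] call for this generality. *)
Lemma Rintegral_scale (k : R) (f : R3 R -> R) : 0 < k ->
  \int[leb3 R]_x (k * f (t *: x)) = (k * t ^- 3) * \int[leb3 R]_x f x.
Proof.
move=> k0.
have c0 : 0 < k * t ^- 3 by rewrite mulr_gt0// invr_gt0 exprn_gt0.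
suff H : (\int[leb3 R]_x (k * f (t *: x))%:E = (k * t ^- 3)%:E * \int[leb3 R]_x (f x)%:E)%E.
  by rewrite /Rintegral H; exact: fineMl_pos.
under eq_integral do rewrite EFinM.
apply: (@integral_change _ _ _ (leb3 R) (fun x => t *: x) (fun x => t^-1 *: x) _ _ (EFin \o f)) => //.
- exact: measurable_scaler3.
- exact: measurable_scaler3.
- by move=> x; rewrite scalerA mulVf ?scale1r ?gt_eqF.
- by move=> x; rewrite scalerA mulfV ?scale1r ?gt_eqF.
- by rewrite invr_gt0 exprn_gt0.
- exact: leb3_scale.
Qed.

End leb3_scale.

(** * Test functions *)

Section flat_exponential.
Context (R : realType).
Implicit Types (P Q : {poly R}) (x y : R).

(* The derivatives of exp(-1/x) extended by 0 to x <= 0 all have this form. *)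
Definition flat P x : R := if 0 < x then P.[x^-1] * expR (- x^-1) else 0.

Lemma exprn_le_expR n y : 0 <= y -> y ^+ n <= n`!%:R * expR y.
Proof.
move=> y0; case: n => [|n].
  by rewrite expr0 fact0 mul1r -expR0 ler_expR.
have := expR_ge1Dxn n y0; move=> H.
rewrite mulrC -ler_pdivrMr ?ltr0n ?fact_gt0//.
by apply: le_trans H; rewrite lerDr.
Qed.

Lemma flat_bounded P : exists2 C : R, 0 <= C & forall x, `|flat P x| <= C.
Proof.
(* With y = 1/x, each monomial satisfies y^i e^(-y) <= i!. *)
exists (\sum_(i < size P) `|P`_i| * i`!%:R).
  by apply: sumr_ge0 => i _; rewrite mulr_ge0.
move=> x; rewrite /flat; case: ifPn => x0; last first.
  by rewrite normr0; apply: sumr_ge0 => i _; rewrite mulr_ge0.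
have xV : 0 <= x^-1 by rewrite invr_ge0 ltW.
rewrite normrM (ger0_norm (expR_ge0 _)) expRN.
rewrite ler_pdivrMr ?expR_gt0// mulr_suml horner_coef.
apply: le_trans (ler_norm_sum _ _ _) _; apply: ler_sum => i _.
rewrite normrM -mulrA ler_wpM2l//.
by rewrite ger0_norm ?exprn_ge0// exprn_le_expR.
Qed.

(** Used twice, this turns the difference quotient at 0 into h times a bounded function, which gives
    derivative 0 there. *)
Lemma flatMX P x : flat P x = x * flat ('X * P) x.
Proof.
rewrite /flat; case: ifPn => x0; last by rewrite mulr0.
by rewrite hornerM hornerX !mulrA mulfV ?mul1r// gt_eqF.
Qed.

Lemma flat_eq0 P x : x <= 0 -> flat P x = 0.
Proof. by rewrite /flat ltNge => ->. Qed.

(** Chain rule in y = 1/x: dy/dx = -y^2, and P(y) e^(-y) has y-derivative (P' - P)(y) e^(-y). *)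
Definition flat_deriv P := 'X * ('X * (P - P^`())).

Lemma is_derive_flat P x : is_derive x 1 (flat P) (flat (flat_deriv P) x).
Proof.
have [x0|x0|->] := ltgtP x 0.
- rewrite flat_eq0 ?ltW//.
  apply: (@near_eq_is_derive _ _ _ (cst 0)).
  near=> z; rewrite flat_eq0// ltW//; near: z.
  exact: lt_nbhsl.
- pose f (z : R) : R := (horner P \o GRing.inv) z * (expR \o (-%R \o GRing.inv)) z.
  apply: (@near_eq_is_derive _ _ _ f).
    near=> z; rewrite /flat ifT//; near: z; exact: lt_nbhsr.
  have xn0 : x != 0 by rewrite gt_eqF.
  have dV : is_derive x 1 (@GRing.inv R) (- x ^- 2 *: 1).
    exact: (@is_deriveV R id x 1 1 xn0 _).
  have dP : is_derive (x^-1) 1 (horner P) (P^`()).[x^-1].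
    exact: is_derive_poly.
  have d1 : is_derive x 1 (horner P \o GRing.inv) ((P^`()).[x^-1] * (- x ^- 2 *: 1)).
    exact: is_derive1_comp.
  have dN : is_derive x 1 (-%R \o GRing.inv) (- (- x ^- 2 *: 1)).
    exact: is_deriveN.
  have d2 : is_derive x 1 (expR \o (-%R \o GRing.inv)) (expR (- x^-1) * (- (- x ^- 2 *: 1))).
    exact: is_derive1_comp.
  have := is_deriveM d1 d2; rewrite -/f => d3.
  apply: (is_derive_eq d3).
  rewrite /flat x0 /flat_deriv /= !hornerE.
  rewrite /GRing.scale/=.
  by field.
- rewrite flat_eq0//.
  have [C C0 HC] := flat_bounded ('X * ('X * P)).
  suff H : (fun h : R => h^-1 *: (flat P (h *: 1 + 0) - flat P 0)) @ 0^' --> (0 : R).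
    split; last exact: cvg_lim H.
    by apply/cvg_ex; exists 0.
  apply/cvgr0Pnorm_lt => e e0.
  near=> h.
  have h0 : h != 0 by near: h; exact: nbhs_dnbhs_neq.
  rewrite (flat_eq0 _ (lexx 0)) subr0 addr0 /GRing.scale/= mulr1.
  rewrite flatMX mulrA mulVf// mul1r flatMX normrM.
  apply: (@le_lt_trans _ _ (`|h| * C)); first by rewrite ler_wpM2l.
  apply: (@le_lt_trans _ _ (`|h| * (C + 1))); first by rewrite ler_wpM2l// lerDl.
  rewrite -ltr_pdivlMr ?ltr_wpDl//.
  near: h; apply: dnbhs0_lt; rewrite divr_gt0// ltr_wpDl//.
Unshelve. all: by end_near. Qed.

End flat_exponential.

Section is_bump.
Context (R : realType).
Variables (al be ga de : R).

(** With the affine arguments fixed, sums of such products are closed under differentiation by the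
    product rule, and all vanish unless both affine arguments are positive. Smoothness and support
    can thus be read off the class. *)
Inductive is_bump : (R -> R) -> Prop :=
| is_bump_flat (P Q : {poly R}) (k : R) :
    is_bump (fun x => k * (flat P (al * x + be) * flat Q (ga * x + de)))
| is_bump_add f g : is_bump f -> is_bump g -> is_bump (f \+ g).

Lemma bump_neq0 f x : is_bump f -> f x != 0 -> 0 < al * x + be /\ 0 < ga * x + de.
Proof.
elim=> [P Q k|{}f g _ IHf _ IHg /=].
  rewrite !mulf_eq0 !negb_or => /and3P[_].
  by rewrite /flat; case: ifPn; case: ifPn; rewrite ?eqxx.
have [/IHf//|/negPn/eqP f0] := boolP (f x != 0).
by rewrite f0 add0r.
Qed.

Lemma bump_is_derive f : is_bump f ->
  exists2 g, is_bump g & forall x : R, is_derive x 1 f (g x).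
Proof.
elim=> [P Q k|{}f1 f2 _ [g1 bg1 dg1] _ [g2 bg2 dg2]]; last first.
  exists (g1 \+ g2); first exact: is_bump_add.
  by move=> x; exact: is_deriveD.
exists ((fun x => (k * al) * (flat (flat_deriv P) (al * x + be) * flat Q (ga * x + de)))
     \+ (fun x => (k * ga) * (flat P (al * x + be) * flat (flat_deriv Q) (ga * x + de)))).
  by apply: is_bump_add; exact: is_bump_flat.
move=> x.
have aff (c d : R) : is_derive x 1 (fun x => c * x + d) c.
  apply: is_derive_eq; rewrite /GRing.scale/=; ring.
have fl P' (c d : R) :
    is_derive x 1 (flat P' \o (fun x => c * x + d)) (flat (flat_deriv P') (c * x + d) * c).
  exact: (@is_derive1_comp _ _ (fun x => c * x + d) _ _ _ (is_derive_flat P' (c * x + d)) (aff c d)).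
have := is_deriveM (fl P al be) (fl Q ga de).
move=> H; have := is_deriveZ k H.
move=> {}H; apply: (is_derive_eq H).
by rewrite /GRing.scale/=; ring.
Qed.

End is_bump.

Lemma is_derive_continuous (R : realType) (f : R -> R) (x df : R) :
  is_derive x 1 f df -> {for x, continuous f}.
Proof.
by move=> [df1 _]; apply/differentiable_continuous/derivable1_diffP.
Qed.

Section tensor.
Context (R : realType).

Definition tensor (f g h : R -> R) (x : R3 R) : R := f x.1.1 * g x.1.2 * h x.2.

Lemma tensor_continuous f g h :
  continuous f -> continuous g -> continuous h -> continuous (tensor f g h).
Proof.
move=> cf cg ch x.
apply: (@continuousM _ _ (fun y : R3 R => f y.1.1 * g y.1.2) (fun y => h y.2)).
  apply: (@continuousM _ _ (fun y : R3 R => f y.1.1) (fun y => g y.1.2)).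
    apply: (@continuous_comp _ _ _ (fun y : R3 R => y.1.1) f); last exact: cf.
    by apply: (@continuous_comp _ _ _ (fun y : R3 R => y.1) fst); exact: cvg_fst.
  apply: (@continuous_comp _ _ _ (fun y : R3 R => y.1.2) g); last exact: cg.
  by apply: (@continuous_comp _ _ _ (fun y : R3 R => y.1) snd); [exact: cvg_fst|exact: cvg_snd].
by apply: (@continuous_comp _ _ _ (fun y : R3 R => y.2) h); [exact: cvg_snd|exact: ch].
Qed.

(** Reduces a directional derivative in R^3 to a one-variable one; [k] collects the factors that
    stay constant along the line. *)
Lemma is_derive_along (f : R3 R -> R) (g : R -> R) (x v : R3 R) (y dg k : R) :
  (forall r : R, f (r *: v + x) = k * g (r + y)) ->
  is_derive y 1 g dg -> is_derive x v f (k * dg).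
Proof.
move=> fg [/cvg_ex[/= l gl] dgE].
have {dgE} ldg : l = dg by rewrite -dgE; apply/esym/cvg_lim.
suff H : (fun r : R => r^-1 *: (f (r *: v + x) - f x)) @ 0^' --> k * dg.
  split; last exact: cvg_lim H.
  by apply/cvg_ex; exists (k * dg).
have E : (fun r : R => r^-1 *: (f (r *: v + x) - f x)) =
         (fun r : R => k * (r^-1 *: (g (r *: 1 + y) - g y))).
  apply/funext => r; have := fg 0; rewrite scale0r !add0r => ->.
  rewrite fg /GRing.scale/= mulr1; ring.
by rewrite E -ldg; apply: cvgMr.
Qed.

Lemma is_derive_tensor f g h f' g' h' (i : 'I_3) (x : R3 R) :
  (forall y : R, is_derive y 1 f (f' y)) -> (forall y : R, is_derive y 1 g (g' y)) ->
  (forall y : R, is_derive y 1 h (h' y)) ->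
  is_derive x (basis3 R i) (tensor f g h)
    (if i == 0 :> nat then tensor f' g h x else
     if i == 1 :> nat then tensor f g' h x else tensor f g h' x).
Proof.
move=> df dg dh; move: i => [[|[|[|//]]] i3]/=.
- have -> : tensor f' g h x = (g x.1.2 * h x.2) * f' x.1.1 by rewrite /tensor; ring.
  apply: (is_derive_along _ (df _)) => r.
  rewrite /tensor /basis3/= {1 2 3}/GRing.scale/= !mulr0 !add0r mulr1; ring.
- have -> : tensor f g' h x = (f x.1.1 * h x.2) * g' x.1.2 by rewrite /tensor; ring.
  apply: (is_derive_along _ (dg _)) => r.
  rewrite /tensor /basis3/= {1 2 3}/GRing.scale/= !mulr0 !add0r mulr1; ring.
- have -> : tensor f g h' x = (f x.1.1 * g x.1.2) * h' x.2 by rewrite /tensor; ring.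
  apply: (is_derive_along _ (dh _)) => r.
  rewrite /tensor /basis3/= {1 2 3}/GRing.scale/= !mulr0 !add0r mulr1; ring.
Qed.

End tensor.

Section tensor_bump.
Context (R : realType).
Variables (a1 b1 c1 d1 a2 b2 c2 d2 a3 b3 c3 d3 : R).

Lemma bump_continuous al be ga de (f : R -> R) : is_bump al be ga de f -> continuous f.
Proof. by move=> /bump_is_derive[g _ dg] x; exact: is_derive_continuous (dg x). Qed.

Lemma iter_partial_tensor_bump (s : seq 'I_3) f g h :
  is_bump a1 b1 c1 d1 f -> is_bump a2 b2 c2 d2 g -> is_bump a3 b3 c3 d3 h ->
  exists f' g' h', [/\ is_bump a1 b1 c1 d1 f', is_bump a2 b2 c2 d2 g',
    is_bump a3 b3 c3 d3 h' & iter_partial s (tensor f g h) = tensor f' g' h'].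
Proof.
move=> bf bg bh; elim: s => [|i s [f' [g' [h' [bf' bg' bh' E]]]]] /=.
  by exists f, g, h.
have [f2 bf2 df2] := bump_is_derive bf'.
have [g2 bg2 dg2] := bump_is_derive bg'.
have [h2 bh2 dh2] := bump_is_derive bh'.
rewrite /iter_partial/= -/(iter_partial s _) E.
have H := fun x => @derive_val _ _ _ _ _ _ _ (is_derive_tensor i x df2 dg2 dh2).
have [i0|i0] := boolP (i == 0 :> nat).
  exists f2, g', h'; split => //; apply/funext => x.
  by rewrite H i0.
have [i1|i1] := boolP (i == 1 :> nat).
  exists f', g2, h'; split => //; apply/funext => x.
  by rewrite H (negbTE i0) i1.
exists f', g', h2; split => //; apply/funext => x.
by rewrite H (negbTE i0) (negbTE i1).
Qed.

Lemma smooth_tensor_bump f g h :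
  is_bump a1 b1 c1 d1 f -> is_bump a2 b2 c2 d2 g -> is_bump a3 b3 c3 d3 h ->
  smooth (tensor f g h).
Proof.
move=> bf bg bh s.
have [f' [g' [h' [bf' bg' bh' ->]]]] := iter_partial_tensor_bump s bf bg bh.
split.
  by apply: tensor_continuous; apply: bump_continuous; [exact: bf'|exact: bg'|exact: bh'].
move=> i x.
have [f2 bf2 df2] := bump_is_derive bf'.
have [g2 bg2 dg2] := bump_is_derive bg'.
have [h2 bh2 dh2] := bump_is_derive bh'.
by have [] := is_derive_tensor i x df2 dg2 dh2.
Qed.

End tensor_bump.

(** * Smooth approximation of half-open intervals *)

Section indicator_approximation.
Context (R : realType).
Implicit Types (a b x : R) (n : nat).

(** With N = n + 1 the arguments are N (x - a) and N (1 - N (x - b)). The first tends to +oo exactly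
    for x > a. The second is at least N for x <= b, the endpoint included, but eventually
    nonpositive for x > b: the extra power of N makes the limit the indicator of an interval closed
    at b and open at a. *)
Definition itv_bump a b n x : R :=
  flat 1 (n.+1%:R * x + (- (n.+1%:R * a))) *
  flat 1 (- (n.+1%:R ^+ 2) * x + (n.+1%:R ^+ 2 * b + n.+1%:R)).

Lemma bump_itv_bump a b n : 
  is_bump n.+1%:R (- (n.+1%:R * a)) (- (n.+1%:R ^+ 2)) (n.+1%:R ^+ 2 * b + n.+1%:R)
    (itv_bump a b n).
Proof.
rewrite (_ : itv_bump a b n = fun x => 1 *
  (flat 1 (n.+1%:R * x + (- (n.+1%:R * a))) *
  flat 1 (- (n.+1%:R ^+ 2) * x + (n.+1%:R ^+ 2 * b + n.+1%:R)))); first exact: is_bump_flat.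
by apply/funext => x; rewrite mul1r.
Qed.

Lemma near_natr1_ge (r : R) : \forall n \near \oo, r <= n.+1%:R.
Proof.
near=> n; apply: (@le_trans _ _ n%:R); last by rewrite ler_nat.
near: n; exact: nbhs_infty_ger.
Unshelve. all: by end_near. Qed.

Lemma flat1_ge0 x : 0 <= flat 1 x.
Proof. by rewrite /flat hornerC mul1r; case: ifPn => // _; rewrite expR_ge0. Qed.

Lemma flat1_le1 x : flat 1 x <= 1.
Proof.
rewrite /flat hornerC mul1r; case: ifPn => // x0.
by rewrite -expR0 ler_expR oppr_le0 invr_ge0 ltW.
Qed.

Lemma itv_bump_ge0 a b n x : 0 <= itv_bump a b n x.
Proof. by rewrite mulr_ge0// flat1_ge0. Qed.

Lemma itv_bump_le1 a b n x : itv_bump a b n x <= 1.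
Proof. by rewrite mulr_ile1// ?flat1_ge0 ?flat1_le1. Qed.

(** The second factor vanishes from b + 1/(n + 1) on; [b + 1] bounds this for all n, so one compact
    box carries every approximant and supplies the dominating function. *)
Lemma itv_bump_neq0 a b n x : itv_bump a b n x != 0 -> a <= x <= b + 1.
Proof.
move=> /(bump_neq0 (bump_itv_bump a b n)) [H1 H2].
have n0 : 0 < n.+1%:R :> R by rewrite ltr0n.
have n1 : 1 <= n.+1%:R :> R by rewrite ler1n.
apply/andP; split.
  by move: H1; rewrite -mulrBr pmulr_rgt0// subr_gt0 => /ltW.
have E : - n.+1%:R ^+ 2 * x + (n.+1%:R ^+ 2 * b + n.+1%:R) =
    n.+1%:R * (1 - n.+1%:R * (x - b)) by ring.
move: H2; rewrite E pmulr_rgt0// => H.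
have [bx|bx] := leP x b; first by rewrite ler_wpDr.
rewrite subr_gt0 in H; rewrite addrC -lerBlDr; apply: le_trans (ltW H).
by rewrite ler_peMl// subr_ge0 ltW.
Qed.

Lemma flat1_cvg (u : nat -> R) :
  u @ \oo --> +oo -> (flat 1 \o u) @ \oo --> (1 : R).
Proof.
move=> uoo.
have uV : (fun n => - (u n)^-1) @ \oo --> (0 : R).
  rewrite -oppr0; apply: cvgN.
  apply/gtr0_cvgV0 => //.
  by move/cvgryPgt : uoo; exact.
have : (expR \o (fun n => - (u n)^-1)) @ \oo --> expR 0.
  by apply: continuous_cvg => //; exact: continuous_expR.
rewrite expR0; apply: cvg_trans; apply: near_eq_cvg.
have /cvgryPgt/(_ 0) u0 := uoo.
near=> n; rewrite /flat/= hornerC mul1r ifT//.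
by near: n; exact: u0.
Unshelve. all: by end_near. Qed.

Lemma itv_bump_cvg a b x :
  itv_bump a b n x @[n --> \oo] --> (\1_(`]a, b]%classic : set R) x : R).
Proof.
rewrite indicE /=.
have [|] := boolP (x \in _).
  rewrite inE/= in_itv/= => /andP[ax xb].
  rewrite -[X in _ --> X]mulr1.
  apply: cvgM; apply: flat1_cvg.
    apply/cvgryPge => A; near=> n.
    rewrite -mulrBr -ler_pdivrMr ?subr_gt0//.
    near: n; exact: near_natr1_ge.
  apply/cvgryPge => A; near=> n.
  apply: (@le_trans _ _ n.+1%:R).
    near: n; exact: near_natr1_ge.
  rewrite addrA lerDr mulNr addrC -mulrBr mulr_ge0 ?sqr_ge0// subr_ge0//.
rewrite notin_setE/= in_itv/= => /negP; rewrite negb_and -!leNgt -ltNge => /orP[xa|bx].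
  apply: cvg_near_cst; near=> n.
  rewrite /itv_bump flat_eq0 ?mul0r//.
  by rewrite -mulrBr mulr_ge0_le0// subr_le0.
apply: cvg_near_cst; near=> n.
rewrite /itv_bump [X in _ * X]flat_eq0 ?mulr0//.
have -> : - n.+1%:R ^+ 2 * x + (n.+1%:R ^+ 2 * b + n.+1%:R) = 
   n.+1%:R * (1 - n.+1%:R * (x - b)) :> R by ring.
rewrite mulr_ge0_le0// subr_le0 -ler_pdivrMr ?subr_gt0//.
near: n; exact: near_natr1_ge.
Unshelve. all: by end_near. Qed.

End indicator_approximation.

(** * Uniqueness of weak derivatives *)

(** The covers serve to write a cylinder as a countable union of rectangles with sides in [G1] and
    [G2], as the whole space need not belong to either generator. *)
Lemma measurable_prod_generated d1 d2 (T1 : measurableType d1) (T2 : measurableType d2)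
    (G1 : set (set T1)) (G2 : set (set T2)) (g1 : (set T1)^nat) (g2 : (set T2)^nat) :
  @measurable _ T1 = <<s G1 >> -> @measurable _ T2 = <<s G2 >> ->
  (forall n, G1 (g1 n)) -> (forall n, G2 (g2 n)) ->
  \bigcup_n g1 n = setT -> \bigcup_n g2 n = setT ->
  @measurable _ (T1 * T2)%type = <<s [set A `*` B | A in G1 & B in G2] >>.
Proof.
move=> m1 m2 Gg1 Gg2 U1 U2; apply/seteqP; split; last first.
  apply: smallest_sub; first exact: sigma_algebra_measurable.
  move=> _ [A GA] [B GB] <-; apply: measurableX.
    by rewrite m1; exact: sub_sigma_algebra.
  by rewrite m2; exact: sub_sigma_algebra.
apply: smallest_sub; first exact: smallest_sigma_algebra.
rewrite subUset m1 m2; split.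
  rewrite -g_sigma_preimageE; apply: smallest_sub; first exact: smallest_sigma_algebra.
  move=> _ [A GA <-]; rewrite setTI.
  rewrite (_ : _ @^-1` _ = \bigcup_n (A `*` g2 n)).
    by apply: sigma_algebra_bigcup => n; apply: sub_sigma_algebra; exists A => //; exists (g2 n).
  by rewrite -setX_bigcupr U2; apply/seteqP; split => -[x y] //= [].
rewrite -g_sigma_preimageE; apply: smallest_sub; first exact: smallest_sigma_algebra.
move=> _ [B GB <-]; rewrite setTI.
rewrite (_ : _ @^-1` _ = \bigcup_n (g1 n `*` B)).
  by apply: sigma_algebra_bigcup => n; apply: sub_sigma_algebra; exists (g1 n) => //; exists B.
by rewrite -setX_bigcupl U1; apply/seteqP; split => -[x y] //= [].
Qed.

Section nng_density.
Local Open Scope ereal_scope.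
Context d (T : measurableType d) (R : realType) (mu : {measure set T -> \bar R}).
Variable f : T -> \bar R.
Hypotheses (mf : measurable_fun setT f) (f0 : forall x, 0 <= f x).

Definition nng_density (A : set T) := \int[mu]_(x in A) f x.

Let nng_density0 : nng_density set0 = 0.
Proof. exact: integral_set0. Qed.

Let nng_density_ge0 A : 0 <= nng_density A.
Proof. exact: integral_ge0. Qed.

Let nng_density_sigma_additive : semi_sigma_additive nng_density.
Proof. exact: semi_sigma_additive_nng_induced. Qed.

HB.instance Definition _ := isMeasure.Build _ _ _ nng_density
  nng_density0 nng_density_ge0 nng_density_sigma_additive.

Definition nng_density_measure : {measure set T -> \bar R} := nng_density.

End nng_density.

Section ae_eq0_pi_system.
Local Open Scope ereal_scope.
Context d (T : measurableType d) (R : realType) (mu : {measure set T -> \bar R}).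
Variables (G : set (set T)) (g : (set T)^nat).
Hypotheses (mG : measurable = <<s G >>) (GI : setI_closed G).
Hypotheses (Gg : forall n, G (g n)) (gT : \bigcup_n g n = setT).

(** On each [g k] the positive and negative parts of f are densities of two measures. They are equal
    and finite on [G], which is stable under intersection with [g k] and where f integrates to 0. By
    uniqueness of measures they agree everywhere, so f integrates to 0 over every measurable subset
    of [g k]. *)
Lemma ae_eq0_pi_system (f : T -> \bar R) : measurable_fun setT f ->
  (forall A, G A -> mu.-integrable A f) ->
  (forall A, G A -> \int[mu]_(x in A) f x = 0) ->
  ae_eq mu setT f (cst 0).
Proof.
move=> mf intf f0.
have mGA A : G A -> measurable A by move=> GA; rewrite mG; exact: sub_sigma_algebra.
suff H k : ae_eq mu (g k) f (cst 0).
  have := ae_foralln H.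
  move=> {}H; apply: filterS H => x H _.
  have : (\bigcup_n g n) x by rewrite gT.
  by move=> [n _ gx]; exact: (H n).
have mgk : measurable (g k) by exact: mGA.
have mp : measurable_fun setT (f^\+ \_ (g k)).
  by apply/(measurable_restrictT _ mgk).1; apply: measurable_funTS; exact: measurable_funepos.
have mn : measurable_fun setT (f^\- \_ (g k)).
  by apply/(measurable_restrictT _ mgk).1; apply: measurable_funTS; exact: measurable_funeneg.
have p0 x : 0 <= (f^\+ \_ (g k)) x by apply: erestrict_ge0 => ? _; exact: funepos_ge0.
have n0 x : 0 <= (f^\- \_ (g k)) x by apply: erestrict_ge0 => ? _; exact: funeneg_ge0.
pose mp' := nng_density_measure mu mp p0.
pose mn' := nng_density_measure mu mn n0.
have pnE A : G A -> mp' A = mn' A /\ mp' A < +oo.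
  move=> GA; rewrite /mp' /mn' /nng_density_measure /= /nng_density.
  rewrite -!integral_mkcondr.
  have GAk : G (A `&` g k) by exact: GI.
  have := f0 _ GAk; rewrite integralE => E.
  have pfin := integrable_pos_fin_num (mGA _ GAk) (intf _ GAk).
  have nfin := integrable_neg_fin_num (mGA _ GAk) (intf _ GAk).
  split; last by rewrite -ge0_fin_numE// integral_ge0.
  by move/eqP : E; rewrite sube_eq ?fin_num_adde_defl// add0e => /eqP.
have E : forall A, measurable A -> mp' A = mn' A.
  apply: (measure_unique G g) => // [A GA|n]; first by have [] := pnE _ GA.
  by have [] := pnE _ (Gg n).
apply: integral_ae_eq => //; first exact: intf.
move=> A Ak mA; rewrite integral0 integralE.
have := E _ mA; rewrite /mp' /mn' /nng_density_measure /= /nng_density.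
rewrite -!integral_mkcondr (setIidl Ak) => ->.
rewrite subee// -(setIidl Ak) .
apply: (integrable_neg_fin_num (measurableI _ _ mA mgk)).
by apply: integrableS (intf _ (Gg k)) => //; exact: measurableI.
Qed.

End ae_eq0_pi_system.

(** * Square-integrable functions *)

Section Lfun2.
Context d (T : measurableType d) (R : realType) (mu : {measure set T -> \bar R}).
Implicit Types (v w : T -> R).

Lemma Lnorm2_sqr v :
  (('N[mu]_2%:E[EFin \o v]) ^+ 2 = \int[mu]_x (v x ^+ 2)%:E)%E.
Proof.
transitivity ('N[mu]_2%:E[EFin \o v] `^ 2)%E.
  have := Lnorm_ge0 mu 2%:E (EFin \o v); case: Lnorm => [r r0|_|//].
    by rewrite poweR_EFin powR_mulrn.
  by rewrite poweRyr ?pnatr_eq0// expe2 mulyy.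
rewrite poweR_Lnorm//; apply: eq_integral => x _ /=.
by rewrite powR_mulrn// real_normK// num_real.
Qed.

Lemma Lfun2P v : v \in Lfun mu 2%:E <->
  measurable_fun setT v /\ (\int[mu]_x (v x ^+ 2)%:E < +oo)%E.
Proof.
rewrite -Lnorm2_sqr; split.
  move=> /andP[/set_mem mv /set_mem fv]; split => //.
  have : ('N[mu]_2%:E[EFin \o v] < +oo)%E := fv.
  by have := Lnorm_ge0 mu 2%:E (EFin \o v); case: Lnorm => // r _ _; rewrite ltry.
move=> [mv fv]; apply/andP; split; apply/mem_set => //.
rewrite /finite_norm; move: fv; rewrite ltey; apply: contraTT.
rewrite ltey negbK => /eqP ->.
by [].
Qed.

Lemma Lfun2_measurable v : v \in Lfun mu 2%:E -> measurable_fun setT v.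
Proof. by move=> /Lfun2P[]. Qed.

Lemma Lfun2B v w : v \in Lfun mu 2%:E -> w \in Lfun mu 2%:E ->
  (v \- w) \in Lfun mu 2%:E.
Proof.
have p1 : (1 <= 2%:E :> \bar R)%E by rewrite lee_fin ler1n.
move=> hv hw; have [_ Z] := Lfun_submod_closed mu p1.
have := Z (-1) w v hw hv.
by rewrite scaleN1r addrC.
Qed.

(** On a set of finite measure the function 1 + v^2 is integrable, and it dominates |v|. *)
Lemma integrable_Lfun2 v B : v \in Lfun mu 2%:E -> measurable B ->
  (mu B < +oo)%E -> mu.-integrable B (EFin \o v).
Proof.
move=> /Lfun2P[mv fv] mB fB.
have i2 : mu.-integrable setT (fun x => (v x ^+ 2)%:E).
  apply/integrableP; split; first by apply/measurable_EFinP; exact: measurable_funX.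
  under eq_integral do rewrite gee0_abs ?lee_fin ?sqr_ge0//.
  exact: fv.
have i1 : mu.-integrable B (cst (1%:E : \bar R)).
  apply/integrableP; split; first exact: measurable_cst.
  by rewrite /= normr1 integral_cst// mul1e.
have i3 : mu.-integrable B (fun x => 1%:E + (v x ^+ 2)%:E)%E.
  by apply: integrableD => //; apply: integrableS i2.
apply: (le_integrable mB _ _ i3).
  by apply/measurable_EFinP; exact: measurable_funTS.
move=> x _ /=; rewrite lee_fin [leRHS]ger0_norm ?addr_ge0 ?sqr_ge0//.
rewrite ler_norml; have := sqr_ge0 (v x - 1); have := sqr_ge0 (v x + 1).
by have := sqr_ge0 (v x); rewrite !expr2 => *; apply/andP; split; nra.
Qed.

Lemma integrable_Lfun2M v (g : T -> R) B : v \in Lfun mu 2%:E -> measurable B ->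
  (mu B < +oo)%E -> measurable_fun setT g ->
  (forall x, `|g x| <= \1_B x) ->
  mu.-integrable setT (fun x => (v x * g x)%:E).
Proof.
move=> hv mB fB mg gB.
have iB : mu.-integrable setT (((EFin \o v) \_ B)).
  by apply/(integrable_mkcond _ mB); exact: integrable_Lfun2.
apply: (le_integrable measurableT _ _ iB).
  by apply/measurable_EFinP; apply: measurable_funM => //; exact: Lfun2_measurable.
move=> x _ /=; rewrite patchE; have := gB x; rewrite indicE.
case: ifPn => xB /= gx.
  by rewrite lee_fin normrM ler_piMr.
by move: gx; rewrite normr_le0 => /eqP ->; rewrite mulr0 normr0.
Qed.

End Lfun2.

(** * Boxes and their bump functions *)

Section box.
Context (R : realType).
Notation mT := (measurableTypeR R).

Definition ocbox (a1 b1 a2 b2 a3 b3 : R) : set (R3 R) :=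
  (`]a1, b1]%classic : set mT) `*` (`]a2, b2]%classic : set mT) `*`
  (`]a3, b3]%classic : set mT).

Definition ccbox (a1 b1 a2 b2 a3 b3 : R) : set (R3 R) :=
  (`[a1, b1]%classic : set mT) `*` (`[a2, b2]%classic : set mT) `*`
  (`[a3, b3]%classic : set mT).

Lemma measurable_ocbox a1 b1 a2 b2 a3 b3 : measurable (ocbox a1 b1 a2 b2 a3 b3).
Proof. by apply: measurableX; [apply: measurableX|]; exact: measurable_itv. Qed.

Lemma measurable_ccbox a1 b1 a2 b2 a3 b3 : measurable (ccbox a1 b1 a2 b2 a3 b3).
Proof. by apply: measurableX; [apply: measurableX|]; exact: measurable_itv. Qed.

Lemma leb3_ccbox_lty a1 b1 a2 b2 a3 b3 : (leb3 R (ccbox a1 b1 a2 b2 a3 b3) < +oo)%E.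
Proof.
have fin (a b : R) : (lebesgue_measure (`[a, b]%classic : set mT) < +oo)%E.
  by rewrite lebesgue_measure_itv/=; case: ifPn => _; rewrite ?ltry// -EFinB ltry.
have m (a b : R) : measurable (`[a, b]%classic : set mT) by exact: measurable_itv.
have f2 : ((@lebesgue_measure R \x @lebesgue_measure R)%E
    ((`[a1, b1]%classic : set mT) `*` (`[a2, b2]%classic : set mT)) < +oo)%E.
  rewrite product_measure1E//.
  by apply: lte_mul_pinfty => //; [rewrite ge0_fin_numE//; exact: fin|exact: fin].
rewrite (_ : leb3 R _ = leb2 R ((`[a1, b1]%classic : set mT) `*`
    (`[a2, b2]%classic : set mT)) * lebesgue_measure (`[a3, b3]%classic : set mT))%E.
  by apply: lte_mul_pinfty; rewrite ?ge0_fin_numE//; exact: fin.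
by apply: product_measure1E => //; exact: measurableX.
Qed.

Lemma leb3_ocbox_lty a1 b1 a2 b2 a3 b3 : (leb3 R (ocbox a1 b1 a2 b2 a3 b3) < +oo)%E.
Proof.
apply: le_lt_trans (leb3_ccbox_lty a1 b1 a2 b2 a3 b3).
apply: le_measure; rewrite ?inE; [exact: measurable_ocbox|exact: measurable_ccbox|].
by move=> x [[/=]]; rewrite !in_itv/= => /andP[/ltW ? ?] /andP[/ltW ? ?] /andP[/ltW ? ?];
  split; [split|]; rewrite /= in_itv/=; apply/andP.
Qed.

Lemma compact_ccbox a1 b1 a2 b2 a3 b3 : compact (ccbox a1 b1 a2 b2 a3 b3).
Proof.
by apply: compact_setX; [apply: compact_setX|]; exact: segment_compact.
Qed.

Definition box_bump a1 b1 a2 b2 a3 b3 (n : nat) : R3 R -> R :=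
  tensor (itv_bump a1 b1 n) (itv_bump a2 b2 n) (itv_bump a3 b3 n).

Lemma box_bump_neq0 a1 b1 a2 b2 a3 b3 n x : box_bump a1 b1 a2 b2 a3 b3 n x != 0 ->
  ccbox a1 (b1 + 1) a2 (b2 + 1) a3 (b3 + 1) x.
Proof.
rewrite /box_bump /tensor mulf_eq0 negb_or => /andP[+ h3].
rewrite mulf_eq0 negb_or => /andP[h1 h2].
by split; [split|]; rewrite /= in_itv/=;
  [exact: itv_bump_neq0 h1|exact: itv_bump_neq0 h2|exact: itv_bump_neq0 h3].
Qed.

Lemma box_bump_ge0 a1 b1 a2 b2 a3 b3 n x : 0 <= box_bump a1 b1 a2 b2 a3 b3 n x.
Proof. by apply: mulr_ge0; [apply: mulr_ge0|]; exact: itv_bump_ge0. Qed.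

Lemma box_bump_le1 a1 b1 a2 b2 a3 b3 n x : box_bump a1 b1 a2 b2 a3 b3 n x <= 1.
Proof.
rewrite /box_bump /tensor.
have [g0 g1] := (@itv_bump_ge0 R, @itv_bump_le1 R).
apply: mulr_ile1; rewrite ?g0 ?g1//; first by apply: mulr_ge0; rewrite g0.
by apply: mulr_ile1; rewrite ?g0 ?g1.
Qed.

Lemma measurable_box_bump a1 b1 a2 b2 a3 b3 n :
  measurable_fun setT (box_bump a1 b1 a2 b2 a3 b3 n).
Proof.
have m a b : measurable_fun [set: mT] (itv_bump a b n).
  by apply: continuous_measurable_fun; exact: bump_continuous (bump_itv_bump a b n).
apply: measurable_funM; first apply: measurable_funM.
- apply: (measurableT_comp (m a1 b1)).
  exact: (measurableT_comp measurable_fst measurable_fst).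
- apply: (measurableT_comp (m a2 b2)).
  exact: (measurableT_comp measurable_snd measurable_fst).
- by apply: (measurableT_comp (m a3 b3)).
Qed.

Lemma test_box_bump a1 b1 a2 b2 a3 b3 n : test_function (box_bump a1 b1 a2 b2 a3 b3 n).
Proof.
split.
  by apply: smooth_tensor_bump; exact: bump_itv_bump.
have K := @compact_ccbox a1 (b1 + 1) a2 (b2 + 1) a3 (b3 + 1).
apply: (subclosed_compact _ K); first exact: closed_closure.
have cK := compact_closed (@norm_hausdorff _ _) K.
rewrite [X in _ `<=` X](closure_id _).1//.
by apply: closure_subset => x /= ; exact: box_bump_neq0.
Qed.

Lemma box_bump_cvg a1 b1 a2 b2 a3 b3 x :
  box_bump a1 b1 a2 b2 a3 b3 n x @[n --> \oo] --> (\1_(ocbox a1 b1 a2 b2 a3 b3) x : R).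
Proof.
have -> : \1_(ocbox a1 b1 a2 b2 a3 b3) x = \1_(`]a1, b1]%classic : set R) x.1.1 *
    \1_(`]a2, b2]%classic : set R) x.1.2 * \1_(`]a3, b3]%classic : set R) x.2 :> R.
  rewrite !indicE -!natrM !mulnb; congr (nat_of_bool _)%:R.
  apply/idP/idP; first by rewrite inE => -[[/= ? ?] ?]; rewrite !mem_set.
  by rewrite inE => /andP[/andP[/set_mem ? /set_mem ?] /set_mem ?].
apply: cvgM; first apply: cvgM; exact: itv_bump_cvg.
Qed.

End box.

Section weak_partial_unique.
Context (R : realType).
Notation mT := (measurableTypeR R).

Let ocitvs : set (set mT) := [set `]x.1, x.2]%classic | x in [set: R * R]].
Let ocboxes : set (set (R3 R)) :=
  [set X `*` Z | X in [set A `*` B | A in ocitvs & B in ocitvs] & Z in ocitvs].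
Let I (n : nat) : set mT := `](- n%:R), n%:R]%classic.

Let I_cover : \bigcup_n I n = setT.
Proof.
rewrite -subTset => x _ /=; exists (Num.truncn `|x|).+1 => //=.
have : `|x| < (Num.truncn `|x|).+1%:R by rewrite truncnS_gt.
by rewrite ltr_norml /I/= in_itv/= => /andP[-> /ltW ->].
Qed.

Let ocitvs_setI : setI_closed ocitvs.
Proof. exact: ocitvI. Qed.

Let ocitvs_I n : ocitvs (I n).
Proof. by exists (- n%:R, n%:R). Qed.

Let setX_cover (T1 T2 : Type) (F : (set T1)^nat) (H : (set T2)^nat) :
  {homo F : m n / (m <= n)%N >-> m `<=` n} -> {homo H : m n / (m <= n)%N >-> m `<=` n} ->
  \bigcup_n F n = setT -> \bigcup_n H n = setT ->
  \bigcup_n (F n `*` H n) = setT.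
Proof.
move=> hF hH FT HT; rewrite -subTset => -[x y] _.
have [m _ Fx] : (\bigcup_n F n) x by rewrite FT.
have [n _ Hy] : (\bigcup_n H n) y by rewrite HT.
exists (maxn m n) => //; split => /=.
  exact: hF (leq_maxl m n) _ Fx.
exact: hH (leq_maxr m n) _ Hy.
Qed.

Let I_homo : {homo I : m n / (m <= n)%N >-> m `<=` n}.
Proof.
move=> m n mn x; rewrite /I/= !in_itv/= => /andP[h1 h2].
have mn' : m%:R <= n%:R :> R by rewrite ler_nat.
by apply/andP; split; [apply: le_lt_trans h1; rewrite lerN2|exact: le_trans mn'].
Qed.

Let IX_homo : {homo (fun n => I n `*` I n) : m n / (m <= n)%N >-> m `<=` n}.
Proof.
by move=> m n mn x [/= h1 h2]; split; [exact: I_homo mn _ h1|exact: I_homo mn _ h2].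
Qed.

(** The Borel structure on the line is defined as the one generated by these intervals, hence the
    choice of half-open boxes. *)
Let mT_generate : @measurable _ mT = <<s ocitvs >>.
Proof. by []. Qed.

Let ocboxes_generate : @measurable _ (R3 R) = <<s ocboxes >>.
Proof.
apply: (measurable_prod_generated (g1 := fun n => I n `*` I n) (g2 := I)) => //.
- exact: (measurable_prod_generated mT_generate mT_generate ocitvs_I ocitvs_I I_cover I_cover).
- by move=> n; exists (I n) => //; exists (I n).
- exact: setX_cover.
Qed.

Let ocboxes_setI : setI_closed ocboxes.
Proof.
move=> _ _ [_ [A1 oA1 [B1 oB1 <-]] [C1 oC1 <-]] [_ [A2 oA2 [B2 oB2 <-]] [C2 oC2 <-]].
exists ((A1 `*` B1) `&` (A2 `*` B2)); last first.
  by exists (C1 `&` C2); [exact: ocitvs_setI|exact: setXI].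
exists (A1 `&` A2); first exact: ocitvs_setI.
by exists (B1 `&` B2); [exact: ocitvs_setI|exact: setXI].
Qed.

Lemma box_bump_le_indic a1 b1 a2 b2 a3 b3 n (x : R3 R) :
  `|box_bump a1 b1 a2 b2 a3 b3 n x| <=
  \1_(ccbox a1 (b1 + 1) a2 (b2 + 1) a3 (b3 + 1)) x.
Proof.
have [->|/box_bump_neq0 Kx] := eqVneq (box_bump a1 b1 a2 b2 a3 b3 n x) 0.
  by rewrite normr0 indicE.
by rewrite indicE mem_set// ger0_norm ?box_bump_ge0// box_bump_le1.
Qed.

Lemma integrable_Lfun2_box_bump w a1 b1 a2 b2 a3 b3 n : w \in Lfun (leb3 R) 2%:E ->
  (leb3 R).-integrable setT (fun x => (w x * box_bump a1 b1 a2 b2 a3 b3 n x)%:E).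
Proof.
move=> w2; apply: (integrable_Lfun2M w2).
- exact: (@measurable_ccbox _ a1 (b1 + 1) a2 (b2 + 1) a3 (b3 + 1)).
- exact: leb3_ccbox_lty.
- exact: measurable_box_bump.
- exact: box_bump_le_indic.
Qed.

Lemma box_bump_separates (w : R3 R -> R) : w \in Lfun (leb3 R) 2%:E ->
  (forall a1 b1 a2 b2 a3 b3 n,
    \int[leb3 R]_x (w x * box_bump a1 b1 a2 b2 a3 b3 n x) = 0) ->
  ae_eq (leb3 R) setT (EFin \o w) (cst 0%E).
Proof.
move=> w2 w0; have mw := Lfun2_measurable w2.
apply: (@ae_eq0_pi_system _ _ _ _ ocboxes (fun n => (I n `*` I n) `*` I n)) => //.
- move=> n; exists (I n `*` I n) => //; by exists (I n) => //; exists (I n).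
- by apply: setX_cover => //; exact: setX_cover.
- exact/measurable_EFinP.
- move=> _ [_ [_ [[a1 b1] _ <-] [_ [[a2 b2] _ <-] <-]] [_ [[a3 b3] _ <-] <-]].
  apply: integrable_Lfun2 => //; first exact: measurable_ocbox.
  exact: leb3_ocbox_lty.
move=> _ [_ [_ [[a1 b1] _ <-] [_ [[a2 b2] _ <-] <-]] [_ [[a3 b3] _ <-] <-]] /=.
rewrite -/(ocbox a1 b1 a2 b2 a3 b3).
pose K := ccbox a1 (b1 + 1) a2 (b2 + 1) a3 (b3 + 1).
have mK : measurable K by exact: measurable_ccbox.
have Kfin : (leb3 R K < +oo)%E by exact: leb3_ccbox_lty.
pose phi := box_bump a1 b1 a2 b2 a3 b3.
have phiK n x : `|phi n x| <= \1_K x by exact: box_bump_le_indic.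
have iphi n : (leb3 R).-integrable setT (fun x => (w x * phi n x)%:E).
  exact: integrable_Lfun2_box_bump.
have phi0 n : (\int[leb3 R]_x (w x * phi n x)%:E)%E = 0%E.
  (* The hypothesis only says that [fine] of this integral is 0; integrability excludes an infinite
     value behind it. *)
  rewrite -[LHS]fineK; last exact: integrable_fin_num.
  by rewrite [X in X%:E](w0 _ _ _ _ _ _ n).
have iwK : (leb3 R).-integrable setT (fun x => (w x * \1_K x)%:E).
  apply: (integrable_Lfun2M w2 mK Kfin) => //.
  by move=> x; rewrite ger0_norm// indicE.
have mB := @measurable_ocbox R a1 b1 a2 b2 a3 b3.
have := @dominated_cvg _ _ _ (leb3 R) setT measurableT (fun n x => (w x * phi n x)%:E)
  (fun x => (w x * \1_(ocbox a1 b1 a2 b2 a3 b3) x)%:E)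
  (fun x => `|(w x * \1_K x)%:E|%E).
move=> H; have {H} : (\int[leb3 R]_x (w x * phi n x)%:E)%E @[n --> \oo] -->
    (\int[leb3 R]_x (w x * \1_(ocbox a1 b1 a2 b2 a3 b3) x)%:E)%E.
  apply: H.
  - by move=> n; exact: measurable_int (iphi n).
  - move=> x _; apply/fine_cvgP; split; first by near=> n.
    by apply: cvgMr; exact: box_bump_cvg.
  - by [].
  - exact: integrable_abse.
  - move=> n x _; rewrite /= lee_fin normrM [leRHS]normrM ler_wpM2l//.
    by rewrite [leRHS]ger0_norm ?phiK// indicE.
under eq_fun do rewrite phi0.
move=> c; rewrite integral_mkcond.
have <- : (\int[leb3 R]_x (w x * \1_(ocbox a1 b1 a2 b2 a3 b3) x)%:E)%E =
    (\int[leb3 R]_x ((EFin \o w) \_ (ocbox a1 b1 a2 b2 a3 b3)) x)%E.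
  by apply: eq_integral => x _; rewrite restrict_EFin patch_indic.
apply/esym; apply: (cvg_unique _ _ c) => //; exact: cvg_cst.
Unshelve. all: by end_near. Qed.

Lemma weak_partial_ae_unique (i : 'I_3) (u v1 v2 : R3 R -> R) :
  v1 \in Lfun (leb3 R) 2%:E -> v2 \in Lfun (leb3 R) 2%:E ->
  is_weak_partial i u v1 -> is_weak_partial i u v2 ->
  {ae leb3 R, forall x, v1 x = v2 x}.
Proof.
move=> h1 h2 d1 d2.
have : ae_eq (leb3 R) setT (EFin \o (v1 \- v2)) (cst 0%E).
  apply: box_bump_separates; first exact: Lfun2B.
  move=> a1 b1 a2 b2 a3 b3 n.
  under eq_Rintegral do rewrite /= mulrBl.
  rewrite RintegralB//; try exact: integrable_Lfun2_box_bump.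
  have t := test_box_bump a1 b1 a2 b2 a3 b3 n.
  by apply/eqP; rewrite subr_eq0 -eqr_opp -(d1 _ t) -(d2 _ t).
apply: filterS => x /(_ Logic.I) [] /eqP; rewrite subr_eq0 => /eqP.
exact.
Qed.

End weak_partial_unique.

(** * Dilations *)

Section scaled_test_function.
Context (R : realType).

Lemma is_derive_line (f : R3 R -> R) (x v : R3 R) : derivable f x v ->
  is_derive (0 : R) 1 (fun r : R => f (r *: v + x)) ('D_v f x).
Proof.
move=> /cvg_ex[/= l fl].
have E : (fun h : R => h^-1 *: (f ((h *: 1 + 0) *: v + x) - f (0 *: v + x))) =
         (fun h : R => h^-1 *: (f (h *: v + x) - f x)).
  by apply/funext => h; rewrite scale0r add0r addr0 /GRing.scale/= mulr1.
have H : (fun h : R => h^-1 *: (f ((h *: 1 + 0) *: v + x) - f (0 *: v + x))) @ 0^' --> l.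
  by rewrite E.
split; first by apply/cvg_ex; exists l.
by rewrite /derive (cvg_lim _ H)// (cvg_lim _ fl).
Qed.

Lemma is_derive_scale (f : R3 R -> R) (t k : R) (x v : R3 R) :
  derivable f (t *: x) v ->
  is_derive x v (fun y => k * f (t *: y)) (k * t * 'D_v f (t *: x)).
Proof.
move=> df.
pose g (r : R) := f (r *: v + t *: x).
have dg : is_derive (t * 0) 1 g ('D_v f (t *: x)) by rewrite mulr0; exact: is_derive_line.
have dt : is_derive (0 : R) 1 ( *%R t) t.
  by apply: is_derive_eq; rewrite /GRing.scale/= mulr1.
have := @is_derive1_comp _ g ( *%R t) 0 _ _ dg dt.
move=> H; rewrite -mulrA (mulrC t).
apply: (is_derive_along _ H) => r /=.
by rewrite addr0 /g scalerDr scalerA.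
Qed.

Lemma iter_partial_scale (s : seq 'I_3) (f : R3 R -> R) (t : R) : smooth f ->
  iter_partial s (fun x => f (t *: x)) =
  (fun x => t ^+ size s * iter_partial s f (t *: x)).
Proof.
move=> sf; elim: s => [|i s IH] /=; first by apply/funext => x; rewrite expr0 mul1r.
rewrite /iter_partial/= -!/(iter_partial s _) IH.
apply/funext => x.
have [_ /(_ i (t *: x)) d] := sf s.
have := @derive_val _ _ _ _ _ _ _ (is_derive_scale (t ^+ size s) d).
by rewrite -exprSr.
Qed.

Lemma scaler3_continuous (t : R) : continuous (fun x : R3 R => t *: x : R3 R).
Proof. by move=> x; exact: scaler_continuous. Qed.

Lemma smooth_scale (f : R3 R -> R) (t : R) : smooth f -> smooth (fun x => f (t *: x)).
Proof.
move=> sf s; rewrite iter_partial_scale//; have [cs ds] := sf s; split.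
  move=> x; apply: (@continuousM _ _ (fun _ : R3 R => t ^+ size s)
      (fun y : R3 R => iter_partial s f (t *: y))); first exact: cst_continuous.
  by apply: continuous_comp; [exact: scaler3_continuous|exact: cs].
by move=> i x; have [] := is_derive_scale (t ^+ size s) (ds i (t *: x)).
Qed.

Lemma test_function_scale (f : R3 R -> R) (t : R) : 0 < t ->
  test_function f -> test_function (fun x => f (t *: x)).
Proof.
move=> t0 [sf cf]; split; first exact: smooth_scale.
pose g (x : R3 R) : R3 R := t^-1 *: x.
have K : compact (g @` closure [set x | f x != 0]).
  apply: continuous_compact => //; apply: continuous_subspaceT.
  exact: scaler3_continuous.
apply: (subclosed_compact _ K); first exact: closed_closure.
rewrite [X in _ `<=` X](closure_id _).1; last exact: (compact_closed (@norm_hausdorff _ _) K).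
apply: closure_subset => x /= fx.
exists (t *: x); first exact: subset_closure.
by rewrite /g scalerA mulVf ?scale1r// gt_eqF.
Qed.

End scaled_test_function.

Section dilation.
Context (R : realType).
Variable t : R.
Hypothesis t0 : 0 < t.
Implicit Types (u v : R3 R -> R).

Let c := t `^ (3 / 2).

Let c_gt0 : 0 < c. Proof. exact: powR_gt0. Qed.

Let c_sqr : c ^+ 2 = t ^+ 3.
Proof.
rewrite /c -powR_mulrn ?powR_ge0// -powRrM -powR_mulrn ?ltW//.
by congr (_ `^ _); field.
Qed.

(** After y = t x, testing the dilate against phi is testing u against psi(y) = phi(y/t), and the
    partial of phi at x is t times that of psi at t x. *)
Lemma is_weak_partial_dilation i u v : is_weak_partial i u v ->
  is_weak_partial i (dilation t u) (fun x => t * c * v (t *: x)).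
Proof.
move=> uv phi tphi.
have tn0 : t != 0 by rewrite gt_eqF.
pose psi (y : R3 R) := phi (t^-1 *: y).
have tpsi : test_function psi by apply: test_function_scale => //; rewrite invr_gt0.
have phiE x : phi x = psi (t *: x) by rewrite /psi scalerA mulVf// scale1r.
have dphiE x : 'D_(basis3 R i) phi x = t * 'D_(basis3 R i) psi (t *: x).
  have d : derivable psi (t *: x) (basis3 R i) by have [/(_ [::])[_]] := tpsi; exact.
  have := @derive_val _ _ _ _ _ _ _ (is_derive_scale 1 d).
  rewrite mul1r => <-; congr ('D_ _ _ _).
  by apply/funext => y; rewrite mul1r phiE.
under eq_Rintegral do rewrite dphiE.
under [in RHS]eq_Rintegral do rewrite phiE.
have tc0 : 0 < t * c by rewrite mulr_gt0.
transitivity (\int[leb3 R]_x (t * c * (u (t *: x) * 'D_(basis3 R i) psi (t *: x)))).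
  by apply: eq_Rintegral => x _; rewrite /dilation -/c; ring.
rewrite (@Rintegral_scale _ t t0 _ (fun x => u x * 'D_(basis3 R i) psi x))// uv//.
rewrite mulrN; congr (- _).
rewrite -(@Rintegral_scale _ t t0 _ (fun x => v x * psi x))//.
by apply: eq_Rintegral => x _; rewrite mulrA.
Qed.

Lemma Lfun2_dilation (k : R) v : 0 < k -> v \in Lfun (leb3 R) 2%:E ->
  (fun x => k * v (t *: x)) \in Lfun (leb3 R) 2%:E.
Proof.
move=> k0 /Lfun2P[mv fv]; apply/Lfun2P; split.
  apply: measurable_funM => //.
  by apply: (measurableT_comp mv); exact: measurable_scaler3.
under eq_integral do rewrite exprMn EFinM.
rewrite (@ge0_integral_scale _ t t0 _ (fun x => (v x ^+ 2)%:E)) ?exprn_gt0//; last first.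
  by move=> x; rewrite lee_fin sqr_ge0.
by apply: lte_mul_pinfty => //; rewrite lee_fin mulr_ge0 ?exprn_ge0 ?invr_ge0 ?exprn_ge0 ?ltW.
Qed.

Lemma weak_partialP i u : H1 R u ->
  weak_partial i u \in Lfun (leb3 R) 2%:E /\ is_weak_partial i u (weak_partial i u).
Proof.
move=> [_ /(_ i)[v v2 uv]].
by apply: (@xgetPex _ (cst 0)
  [set v | v \in Lfun (leb3 R) 2%:E /\ is_weak_partial i u v]); exists v.
Qed.

(** The derivative chosen for the dilate need not be the dilate of the one chosen for u, but both
    are weak derivatives in L^2, so they agree almost everywhere. *)
Lemma weak_partial_dilation i u : H1 R u ->
  [/\ weak_partial i (dilation t u) \in Lfun (leb3 R) 2%:E &
  {ae leb3 R, forall x, weak_partial i (dilation t u) x = t * c * weak_partial i u (t *: x)}].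
Proof.
move=> hu; have [w2 uw] := weak_partialP i hu.
have d2 : (fun x => t * c * weak_partial i u (t *: x)) \in Lfun (leb3 R) 2%:E.
  by apply: Lfun2_dilation => //; rewrite mulr_gt0.
have dw := is_weak_partial_dilation uw.
have [w2' uw'] : [set v | v \in Lfun (leb3 R) 2%:E /\
    is_weak_partial i (dilation t u) v] (weak_partial i (dilation t u)).
  by apply: (@xgetPex _ (cst 0)); exists (fun x => t * c * weak_partial i u (t *: x)).
split => //.
exact: weak_partial_ae_unique uw' dw.
Qed.

Lemma Afun_dilation u : H1 R u -> Afun (dilation t u) = ((t ^+ 2)%:E * Afun u)%E.
Proof.
move=> hu; rewrite /Afun.
have m i : measurable_fun setT (weak_partial i u).
  by have [/Lfun2_measurable] := weak_partialP i hu.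
(* [t ^+ 5] is (t c)^2 with c^2 = t^3; the Jacobian t^-3 then leaves t^2. *)
transitivity (\int[leb3 R]_x ((t ^+ 5)%:E * (grad_dot u u (t *: x))%:E))%E.
  apply: ae_eq_integral => //.
  - apply/measurable_EFinP; apply: measurable_sum => i.
    by apply: measurable_funM; have [/Lfun2_measurable] := weak_partial_dilation i hu.
  - apply/measurable_EFinP; apply: measurable_funM => //; apply: measurable_sum => i.
    by apply: measurable_funM; apply: (measurableT_comp (m i)); exact: measurable_scaler3.
  have : {ae leb3 R, forall x, forall i, 
      weak_partial i (dilation t u) x = t * c * weak_partial i u (t *: x)}.
    have H (i : 'I_3) := (weak_partial_dilation i hu).2.
    (* The three exceptional null sets are merged by viewing them as a sequence through [inord]. *)
    have := ae_foralln (fun n => H (inord n)).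
    by apply: filterS => x Hx i; rewrite -(inord_val i).
  apply: filterS => x Hx _; rewrite -EFinM; congr EFin.
  rewrite /grad_dot mulr_sumr; apply: eq_bigr => i _.
  rewrite !Hx (_ : t ^+ 5 = t ^+ 2 * c ^+ 2); first by ring.
  by rewrite c_sqr -exprD.
rewrite (@ge0_integral_scale _ t t0 _ (fun x => (grad_dot u u x)%:E)) ?exprn_gt0//; last first.
  by move=> x; rewrite lee_fin sumr_ge0// => i _; rewrite -expr2 sqr_ge0.
by congr (_%:E * _)%E; field; rewrite gt_eqF.
Qed.

Lemma enormZ (k : R) (x : R3 R) : 0 <= k -> enorm (k *: x) = k * enorm x.
Proof.
move=> k0; rewrite /enorm/= -[X in X * _](ger0_norm k0) -sqrtr_sqr -sqrtrM ?sqr_ge0//.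
by congr Num.sqrt; rewrite /GRing.scale/=; ring.
Qed.

Lemma enorm_ge0 (x : R3 R) : 0 <= enorm x.
Proof. exact: sqrtr_ge0. Qed.

Lemma Bfun_dilation u : Bfun (dilation t u) = (t%:E * Bfun u)%E.
Proof.
rewrite /Bfun.
pose K (x y : R3 R) : \bar R := (`|u x| ^+ 2 * `|u y| ^+ 2 / enorm (x - y))%:E.
have K0 x y : (0 <= K x y)%E.
  by rewrite lee_fin mulr_ge0 ?invr_ge0 ?enorm_ge0// mulr_ge0 ?exprn_ge0.
have tn0 : t != 0 by rewrite gt_eqF.
(* The four factors c give t^6 and the kernel gives one more t; the inner Jacobian t^-3 leaves t^4
   and the outer one leaves t. *)
transitivity (\int[leb3 R]_x ((t ^+ 4)%:E * (\int[leb3 R]_y K (t *: x) y)%E))%E.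
  apply: eq_integral => x _.
  rewrite (_ : (t ^+ 4) = (t ^+ 7 * t ^- 3)); last by field.
  rewrite -(@ge0_integral_scale _ t t0 _ (K (t *: x)))//; last exact: exprn_gt0.
  apply: eq_integral => y _; rewrite /K -EFinM; congr EFin.
  rewrite -scalerBr enormZ ?ltW// invfM /dilation -/c !normrM !exprMn.
  rewrite (ger0_norm (ltW c_gt0)) c_sqr.
  by move: (enorm (x - y))^-1 => e; field.
rewrite (@ge0_integral_scale _ t t0 _ (fun x => (\int[leb3 R]_y K x y)%E)) ?exprn_gt0//.
  by congr (_%:E * _)%E; field.
by move=> x; exact: integral_ge0.
Qed.

Lemma Cfun_dilation p u : Cfun p (dilation t u) = ((t `^ sigma p)%:E * Cfun p u)%E.
Proof.
rewrite /Cfun.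
transitivity (\int[leb3 R]_x ((c `^ p)%:E * (`|u (t *: x)| `^ p)%:E))%E.
  apply: eq_integral => x _; rewrite -EFinM /dilation -/c normrM powRM//.
  by rewrite (ger0_norm (ltW c_gt0)).
rewrite (@ge0_integral_scale _ t t0 _ (fun x => (`|u x| `^ p)%:E)) ?powR_gt0//.
congr (_%:E * _)%E; rewrite /c -powRrM -powR_mulrn ?ltW// -powRN -powRD; last first.
  by apply/implyP => _; rewrite gt_eqF.
by congr (_ `^ _); rewrite /sigma; field.
Qed.

End dilation.

(** * The fiber map *)

Section fiber_derivatives.
Context (R : realType) (p gam a : R) (u : R3 R -> R).
Hypothesis hu : H1 R u.

Let A := fine (Afun u).
Let B := fine (Bfun u).
Let C := fine (Cfun p u).

Lemma fiberE (t : R) : 0 < t ->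
  fiber p gam a u t =
  1 / 2 * A * t ^+ 2 - gam / 4 * B * t - a / p * C * t `^ sigma p.
Proof.
move=> t0; rewrite /fiber /Ffun Afun_dilation// Bfun_dilation// Cfun_dilation//.
rewrite !fineMl_pos ?exprn_gt0 ?powR_gt0// -/A -/B -/C.
ring.
Qed.

Lemma is_derive_fiber (t : R) : 0 < t ->
  is_derive t 1 (fiber p gam a u)
    (A * t - gam / 4 * B - a / p * sigma p * C * t `^ (sigma p - 1)).
Proof.
move=> t0.
apply: (@near_eq_is_derive _ _ _
    (fun t : R => 1 / 2 * A * t ^+ 2 - gam / 4 * B * t - a / p * C * t `^ sigma p)).
  by near=> s; rewrite fiberE//; near: s; exact: lt_nbhsr.
have d1 : is_derive t 1 (fun t : R => t ^+ 2) (2 * t).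
  by apply: is_derive_eq; rewrite /GRing.scale/=; ring.
have d2 := is_derive1_powR (sigma p) t0.
have d3 := is_deriveB (is_deriveB (is_deriveZ (1 / 2 * A) d1)
  (is_deriveZ (gam / 4 * B) (is_derive_id t (1 : R)))) (is_deriveZ (a / p * C) d2).
by apply: (is_derive_eq d3); rewrite /GRing.scale/=; move: (a / p) => k; field.
Unshelve. all: by end_near. Qed.

Lemma derive1_fiber_at1 :
  derive1 (fiber p gam a u) 1 = A - gam / 4 * B - a / p * sigma p * C.
Proof.
by rewrite derive1E (@derive_val _ _ _ _ _ _ _ (is_derive_fiber ltr01)) powR1 !mulr1.
Qed.

Lemma derive1n2_fiber_at1 :
  derive1n 2 (fiber p gam a u) 1 = A - a / p * sigma p * (sigma p - 1) * C.
Proof.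
rewrite /derive1n/= derive1E.
rewrite (@near_eq_derive _ _ _ _ (fun t : R => 
  A * t - gam / 4 * B - a / p * sigma p * C * t `^ (sigma p - 1))); last first.
  near=> t; rewrite derive1E; apply: (@derive_val _ _ _ _ _ _ _ (is_derive_fiber _)).
  by near: t; exact: lt_nbhsr ltr01.
have d2 := is_derive1_powR (sigma p - 1) (@ltr01 R).
have d3 := is_deriveB (is_deriveB (is_deriveZ A (is_derive_id (1 : R) (1 : R)))
  (is_derive_cst (gam / 4 * B : R) (1 : R) (1 : R))) (is_deriveZ (a / p * sigma p * C) d2).
rewrite (@derive_val _ _ _ _ _ _ _ d3) powR1 /GRing.scale/=; ring.
Unshelve. all: by end_near. Qed.

End fiber_derivatives.

(** * The terms of the equation tested with its solution *)

Section weak_equation.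
Context (R : realType) (u : R3 R -> R).

Lemma Bfun_ge0 : (0 <= Bfun u)%E.
Proof.
apply: integral_ge0 => x _; apply: integral_ge0 => y _.
by rewrite lee_fin mulr_ge0 ?invr_ge0 ?sqrtr_ge0// mulr_ge0 ?exprn_ge0.
Qed.

(** An inequality only: where the potential is infinite, [fine] makes the left integrand 0. The
    upper bound suffices, since this term enters the estimate of the multiplier with the positive
    factor gam. *)
Lemma Rintegral_potential_le : Bfun u \is a fin_num ->
  \int[leb3 R]_x (fine (potential u x) * u x * u x) <= fine (Bfun u).
Proof.
move=> fB.
have P0 x : (0 <= potential u x)%E.
  apply: integral_ge0 => y _.
  by rewrite lee_fin mulr_ge0 ?invr_ge0 ?sqrtr_ge0// exprn_ge0.
have f0 x : (0 <= (fine (potential u x) * u x * u x)%:E)%E.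
  by rewrite lee_fin -mulrA mulr_ge0 ?fine_ge0// -expr2 sqr_ge0.
have le : (\int[leb3 R]_x (fine (potential u x) * u x * u x)%:E <= Bfun u)%E.
  apply: ge0_le_integral_nomeas => // x.
  have [ux|ux] := eqVneq (u x) 0.
    rewrite ux mulr0; apply: integral_ge0 => y _.
    by rewrite lee_fin mulr_ge0 ?invr_ge0 ?sqrtr_ge0// mulr_ge0 ?exprn_ge0.
  have ux0 : 0 < `|u x| ^+ 2 by rewrite exprn_gt0// normr_gt0.
  (* The substitution with t = 1 pulls the constant |u x|^2 out of the integral without any
     measurability. *)
  have := @ge0_integral_scale R 1 ltr01 _ (fun y => (`|u y| ^+ 2 / enorm (x - y))%:E) ux0.
  rewrite expr1n invr1 mulr1 => H.
  rewrite (_ : (\int[leb3 R]_y _ = (`|u x| ^+ 2)%:E * potential u x)%E); last first.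
    rewrite /potential -H; last first.
      move=> y; rewrite lee_fin mulr_ge0 ?invr_ge0 ?sqrtr_ge0// exprn_ge0//.
    by apply: eq_integral => y _; rewrite scale1r -EFinM; congr EFin; rewrite -mulrA.
  rewrite real_normK ?num_real//.
  have := P0 x; case: (potential u x) => [r _|_|//] /=.
    by rewrite -EFinM lee_fin expr2 le_eqVlt; apply/orP; left; apply/eqP; ring.
  by rewrite !mul0r mule_ge0// lee_fin sqr_ge0.
apply: fine_le => //.
rewrite ge0_fin_numE; last exact: integral_ge0.
apply: le_lt_trans le _; rewrite -ge0_fin_numE//.
exact: Bfun_ge0.
Qed.

Lemma Rintegral_power (p : R) : p != 0 ->
  \int[leb3 R]_x (`|u x| `^ (p - 2) * u x * u x) = fine (Cfun p u).
Proof.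
move=> p0; congr fine; apply: eq_integral => x _; congr EFin.
rewrite -mulrA -expr2 -(real_normK (num_real (u x))) -powR_mulrn// -powRD ?subrK//.
by rewrite (negbTE p0).
Qed.

Lemma Rintegral_sqr (c : R) : sphere c u -> \int[leb3 R]_x (u x * u x) = c.
Proof.
move=> [_]; rewrite Lnorm2_sqr => E.
by rewrite /Rintegral; under eq_integral do rewrite -expr2; rewrite E.
Qed.

End weak_equation.

(** * Bounds on the level and on the Lagrange parameter *)

Theorem lemma3p24 (R : realType) (p gam a KH KGN : R)
    (hp : 10 / 3 < p <= 6) (hgam : 0 < gam) (ha : 0 < a)
    (hKH : 0 < KH) (hKGN : 0 < KGN)
    (hB : forall (c : R) (u : R3 R -> R), 0 < c -> sphere c u ->
       (Bfun u <= (KH * Num.sqrt (fine (Afun u)) * c `^ (3 / 2))%:E)%E)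
    (hC : forall (c : R) (u : R3 R -> R), 0 < c -> sphere c u ->
       (Cfun p u <= (KGN * fine (Afun u) `^ (sigma p / 2) * c `^ ((6 - p) / 4))%:E)%E) :
  exists K1 K2 : R, [/\ 0 < K1, 0 < K2 &
    forall c : R, 0 < c < c1 p gam a KH KGN ->
    forall (lam : R) (u : R3 R -> R),
      Lambda_plus p gam a c u ->
      (Ffun p gam a u)%:E = gamma_plus p gam a c ->
      weak_solution p gam a lam u ->
      (`| gamma_plus p gam a c | <= (K1 * c ^+ 3)%:E)%E /\ lam <= K2 * c ^+ 2].
Proof.
have p0 : 0 < p by lra.
have [s sE] : {s | s = sigma p} by exists (sigma p).
have s2 : 2 < s by rewrite sE /sigma; lra.
(* With q = sqrt(A) and d = c^(3/2), the constraints will give (s - 2) q^2 <= (s - 1) gam KH q d /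
   4; cancelling one q leaves q <= M d. *)
have [M ME] : {M | M = (s - 1) * gam * KH / (4 * (s - 2))} by eexists.
have M0 : 0 < M by rewrite ME divr_gt0// ?mulr_gt0// subr_gt0//; lra.
(* The first witness bounds A / c^3. In the second, the summands bound gam B / c^3, through B <= KH
   q d, and a C / c^3, through a C <= p A / (s (s - 1)). *)
exists (M ^+ 2), (gam * KH * M + p / (s * (s - 1)) * M ^+ 2).
have ps0 : 0 < p / (s * (s - 1)) by rewrite divr_gt0// mulr_gt0//; lra.
split; first by rewrite exprn_gt0.
  by apply: addr_gt0; [rewrite !mulr_gt0|rewrite (mulr_gt0 ps0)// exprn_gt0].
(* The level is attained at u, so rewriting by that equality turns the first claim into a bound on
   F(u). *)
move=> c /andP[c0 _] lam u [Su d1 d2] <- [_ /(_ u)].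
have hu : H1 R u by case: Su.
move=> /(_ hu) eqn.
move: d1 d2; rewrite derive1_fiber_at1// derive1n2_fiber_at1//.
set A := fine (Afun u); set B := fine (Bfun u); set C := fine (Cfun p u).
rewrite -sE => d1 d2.
have A0 : 0 <= A.
  apply: fine_ge0; apply: integral_ge0 => x _; rewrite lee_fin sumr_ge0// => i _.
  by rewrite -expr2 sqr_ge0.
have B0' := Bfun_ge0 u.
have C0 : 0 <= C.
  by apply: fine_ge0; apply: integral_ge0 => x _; rewrite lee_fin powR_ge0.
(* An infinite B would be read as 0 by [fine]; the bound [hB] excludes it. *)
have Bfin : Bfun u \is a fin_num.
  by rewrite ge0_fin_numE//; apply: le_lt_trans (hB _ _ c0 Su) _; rewrite ltry.
set q := Num.sqrt A; set d := c `^ (3 / 2).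
have q0 : 0 <= q by exact: sqrtr_ge0.
have Aq : A = q ^+ 2 by rewrite sqr_sqrtr.
have dn0 : 0 < d by exact: powR_gt0.
have d2E : d ^+ 2 = c ^+ 3.
  rewrite /d -powR_mulrn ?powR_ge0// -powRrM -powR_mulrn ?ltW//.
  by congr (_ `^ _); field.
have hBq : B <= KH * q * d.
  by rewrite -lee_fin fineK//; exact: hB.
have B0 : 0 <= B by exact: fine_ge0.
have qM : q <= M * d.
  have H : (s - 2) * q ^+ 2 <= (s - 1) * gam / 4 * (KH * q * d).
    have H1 : (s - 2) * q ^+ 2 <= (s - 1) * gam / 4 * B.
      (* (s - 1) g'(1) and g''(1) carry the same multiple of C, so their difference involves A and B
         only. *)
      have : (s - 1) * (A - gam / 4 * B - a / p * s * C) = 0 by rewrite d1 mulr0.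
      rewrite -Aq; lra.
    apply: le_trans H1 _; apply: ler_wpM2l => //.
    by rewrite divr_ge0// mulr_ge0//; lra.
  have [->|qn0] := eqVneq q 0; first by rewrite mulr_ge0// ltW.
  have qp : 0 < q by rewrite lt_neqAle eq_sym qn0.
  rewrite ME mulrAC ler_pdivlMr; last by rewrite mulr_gt0//; lra.
  rewrite -(ler_pM2r qp); lra.
have AM : A <= M ^+ 2 * c ^+ 3.
  by rewrite Aq -d2E -exprMn; apply: lerXn2r; rewrite ?nnegrE// mulr_ge0// ltW.
(* The convexity condition g''(1) > 0 alone controls C by A. *)
have aC : a * C <= p / (s * (s - 1)) * A.
  rewrite mulrAC ler_pdivlMr; last by rewrite mulr_gt0//; lra.
  have : 0 < p * (A - a / p * s * (s - 1) * C) by rewrite mulr_gt0.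
  have -> : p * (A - a / p * s * (s - 1) * C) = p * A - a * C * (s * (s - 1)).
    by field; rewrite gt_eqF.
  lra.
split.
  rewrite lee_fin; apply: le_trans AM.
  have FE : Ffun p gam a u = - (1 / 2) * A + a / p * (s - 1) * C.
    rewrite /Ffun -/A -/B -/C.
    have -> : gam / 4 * B = A - a / p * s * C by lra.
    by move: (a / p) => k; field.
  have h : 0 <= a / p * (s - 1) * C by rewrite !mulr_ge0 ?invr_ge0//; lra.
  (* By g''(1) > 0, s times the left side is below A, and s > 2. *)
  have h2 : a / p * (s - 1) * C <= A.
    have : 2 * (a / p * (s - 1) * C) <= s * (a / p * (s - 1) * C).
      by apply: ler_wpM2r => //; lra.
    lra.
  rewrite FE ler_norml; lra.
have P := Rintegral_potential_le Bfin.
move: eqn; rewrite Rintegral_power ?gt_eqF// (Rintegral_sqr Su) -/A -/C.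
set P' := Rintegral _ _ (fun x => fine _ * _ * _) in P *.
set A' := Rintegral _ _ _.
have -> : A' = A by [].
rewrite -/B in P; move=> eqn.
(* The tested equation reads A + lam c = gam P' + a C; A >= 0 is dropped, and it remains to bound
   the right side by the second constant times c^3. *)
rewrite -(ler_pM2r c0).
have gP : gam * P' <= gam * KH * M * c ^+ 3.
  apply: (@le_trans _ _ (gam * (KH * q * d))).
    by apply: ler_wpM2l; [exact: ltW|exact: le_trans P hBq].
  have -> : gam * (KH * q * d) = gam * KH * d * q by ring.
  have -> : gam * KH * M * c ^+ 3 = gam * KH * d * (M * d) by rewrite -d2E; ring.
  by apply: ler_wpM2l => //; rewrite !mulr_ge0// ltW.
have aC' : a * C <= p / (s * (s - 1)) * M ^+ 2 * c ^+ 3.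
  by apply: le_trans aC _; rewrite -[leRHS]mulrA; apply: ler_wpM2l => //; exact: ltW.
have -> : (gam * KH * M + p / (s * (s - 1)) * M ^+ 2) * c ^+ 2 * c =
  gam * KH * M * c ^+ 3 + p / (s * (s - 1)) * M ^+ 2 * c ^+ 3 by ring.
lra.
Qed.
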